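(* Let $\Bbbk$ be a field, let $G$ be a nontrivial finite group with $\operatorname{char}\Bbbk\nmid |G|$, and let $R$ be a noetherian left $G$-module algebra over $\Bbbk$. Let $\mathfrak r=\mathfrak r(R,G)$ be the $G$-radical of $R$, $B=R*G$ the skew group algebra and $\mathfrak b=\mathfrak r\otimes\Bbbk G\subseteq B$. Assume that $\mathfrak r$ has the right Artin–Rees property. Let $N$ and $M$ be right $B$-modules with $N$ finitely generated, and write $\mathcal N,\mathcal M$ for their images in $\operatorname{QMod}_{\mathfrak b}B$ and also (regarding $N,M$ as right $R$-modules) in $\operatorname{QMod}_{\mathfrak r}R$. Then: (i) $\operatorname{Ext}^i_{\operatorname{QMod}_{\mathfrak r}R}(\mathcal N,\mathcal M)$ has a right $G$-action for all $i\ge 0$; (ii) $\operatorname{Ext}^i_{\operatorname{QMod}_{\mathfrak r}R}(\mathcal N,\mathcal M)^G\cong\operatorname{Ext}^i_{\operatorname{QMod}_{\mathfrak b}B}(\mathcal N,\mathcal M)$ for all $i\ge0$.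
   Context: All algebras are $\Bbbk$-algebras; noetherian means left and right noetherian. A left $G$-module algebra $R$ is an algebra on which $G$ acts by $\Bbbk$-algebra automorphisms. The skew group algebra $R*G$ is $R\otimes\Bbbk G$ with $(r\otimes g)(s\otimes h)=r(g\cdot s)\otimes gh$. Pertinent sequences and $G$-radical: sequences $(a_1,\dots,a_n)$, $(b_1,\dots,b_n)$ in $R$ are pertinent under the $G$-action if $\sum_{i}a_i(g\cdot b_i)=0$ for all $1\ne g\in G$. The $G$-radical is the two-sided ideal $\mathfrak r(R,G)=\{\sum_{i=1}^n a_ib_i : n\ge 1,\ (a_1,\dots,a_n),(b_1,\dots,b_n)\text{ pertinent under the }G\text{-action}\}$ of $R$; it is $G$-stable, so $\mathfrak b$ is an ideal of $B$. Right Artin–Rees (AR) property of an ideal $\mathfrak s$ of a noetherian algebra $S$: for every right ideal $\mathfrak c$ of $S$ there is $n$ with $\mathfrak c\cap\mathfrak s^n\subseteq\mathfrak c\mathfrak s$. Quotient categories: for an ideal $\mathfrak s$ of a noetherian algebra $S$, $\operatorname{Mod}S$ is the category of right $S$-modules, $\Gamma_{\mathfrak s}=\varinjlim_n\operatorname{Hom}_S(S/\mathfrak s^n,-)$, a right module $M$ is $\mathfrak s$-torsion if $\Gamma_{\mathfrak s}(M)=M$ (and $\mathfrak s$-torsion-free if $\Gamma_{\mathfrak s}(M)=0$), $\operatorname{Tor}_{\mathfrak s}S$ is the full subcategory of $\mathfrak s$-torsion modules, and $\operatorname{QMod}_{\mathfrak s}S=\operatorname{Mod}S/\operatorname{Tor}_{\mathfrak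 s}S$ is the Serre quotient. The $G$-action: for right $B$-modules $N,M$ the space $\operatorname{Hom}_R(N,M)$ has the right $G$-action $(f\leftharpoonup g)(n)=f(ng^{-1})g$. Each $N\mathfrak r^n$ is a right $B$-submodule of $N$, and for $N$ finitely generated $\operatorname{Hom}_{\operatorname{QMod}_{\mathfrak r}R}(\mathcal N,\mathcal M)=\varinjlim_n\operatorname{Hom}_R(N\mathfrak r^n,M)$ acquires the induced right $G$-action, natural in the $B$-module $M$. The $G$-action on $\operatorname{Ext}^i_{\operatorname{QMod}_{\mathfrak r}R}(\mathcal N,\mathcal M)$ is the one induced on cohomology by applying $\operatorname{Hom}_{\operatorname{QMod}_{\mathfrak r}R}(\mathcal N,-)$ to the image in the quotient category of an injective resolution of $M$ in $\operatorname{Mod}B$. The superscript $G$ denotes the subspace of $G$-invariants. *)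

(* Defs.v *)
From HB Require Import structures.
From mathcomp Require Import all_boot all_order all_algebra fingroup.
From mathcomp Require Import boolp.

Set Implicit Arguments.
Unset Strict Implicit.
Unset Printing Implicit Defensive.

Import GRing.Theory.
Local Open Scope ring_scope.

Record equivalence_prop (T : Type) (E : T -> T -> Prop) : Prop := {
  eqv_refl : forall x, E x x;
  eqv_sym : forall x y, E x y -> E y x;
  eqv_trans : forall x y z, E x y -> E y z -> E x z }.

Section ClassicalQuotient.
Variables (T : Type) (E : T -> T -> Prop).

Record cquot := CQuot { cq_class : T -> Prop; cq_ex : exists x, cq_class = E x }.

Definition cpi (x : T) : cquot := CQuot (ex_intro _ x erefl).
Definition crepr (q : cquot) : T := projT1 (cid (cq_ex q)).

Lemma cq_inj (p q : cquot) : cq_class p = cq_class q -> p = q.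
Proof.
by case: p q => [A hA] [B hB] /= eAB; subst B; rewrite (Prop_irrelevance hA hB).
Qed.

Lemma creprK q : cpi (crepr q) = q.
Proof. by apply: cq_inj; rewrite /crepr /=; case: cid. Qed.

Lemma cpiW (P : cquot -> Prop) : (forall x, P (cpi x)) -> forall q, P q.
Proof. by move=> h q; rewrite -[q]creprK. Qed.

Hypothesis eqvE : equivalence_prop E.

Lemma cpiP x y : cpi x = cpi y <-> E x y.
Proof.
case: eqvE => hr hs ht; split=> [[eE]|h].
  by rewrite eE; apply: hr.
apply: cq_inj => /=; apply/funext => z; apply/propext; split=> h'.
  exact: ht (hs _ _ h) h'.
exact: ht h h'.
Qed.

Lemma crepr_pi x : E (crepr (cpi x)) x.
Proof. by apply/cpiP; rewrite creprK. Qed.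

End ClassicalQuotient.

Record submod (K : pzRingType) (V : lmodType K) := Submod {
  sm_in :> V -> Prop;
  sm_0 : sm_in 0;
  sm_D : forall x y, sm_in x -> sm_in y -> sm_in (x + y);
  sm_Z : forall c x, sm_in x -> sm_in (c *: x) }.

Section SubQuotient.
Variables (K : pzRingType) (V : lmodType K) (P : submod V).

Definition sm_pred : pred V := fun v => `[< P v >].

Record sub_mod := SubMod { sub_val :> V; sub_in : sm_pred sub_val }.

HB.instance Definition _ := [isSub for sub_val].
HB.instance Definition _ := [Choice of sub_mod by <:].

Fact sm_pred_closed : subsemimod_closed sm_pred.
Proof.
split; first split.
- exact/asboolP/sm_0.
- by move=> x y /asboolP Px /asboolP Py; apply/asboolP/sm_D.
- by move=> c x /asboolP Px; apply/asboolP/sm_Z.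
Qed.

HB.instance Definition _ :=
  GRing.SubChoice_isSubLmodule.Build K V sm_pred sub_mod sm_pred_closed.

Lemma sm_N x : P x -> P (- x).
Proof. by rewrite -scaleN1r; apply: sm_Z. Qed.

Lemma sm_B x y : P x -> P y -> P (x - y).
Proof. by move=> Px Py; apply: sm_D => //; apply: sm_N. Qed.

Definition quo_rel (x y : V) : Prop := P (x - y).

Fact quo_rel_equiv : equivalence_prop quo_rel.
Proof.
split.
- by move=> x; rewrite /quo_rel subrr; apply: sm_0.
- by move=> x y h; rewrite /quo_rel -opprB; apply: sm_N.
- by move=> x y z h1 h2; rewrite /quo_rel -(subrK y x) -addrA; apply: sm_D.
Qed.

Definition quo_mod := cquot quo_rel.
HB.instance Definition _ := gen_eqMixin quo_mod.
HB.instance Definition _ := gen_choiceMixin quo_mod.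

Definition quo_pi (x : V) : quo_mod := cpi quo_rel x.

Lemma quo_piP x y : (quo_pi x = quo_pi y) <-> P (x - y).
Proof. exact: (cpiP quo_rel_equiv). Qed.

Lemma quo_piW (T : quo_mod -> Prop) : (forall x, T (quo_pi x)) -> forall q, T q.
Proof. exact: cpiW. Qed.

Definition quo_add (p q : quo_mod) : quo_mod := quo_pi (crepr p + crepr q).
Definition quo_opp (p : quo_mod) : quo_mod := quo_pi (- crepr p).
Definition quo_scale c (p : quo_mod) : quo_mod := quo_pi (c *: crepr p).

Lemma quo_reprP x : P (crepr (quo_pi x) - x).
Proof. exact: (crepr_pi quo_rel_equiv). Qed.

Lemma quo_addE x y : quo_add (quo_pi x) (quo_pi y) = quo_pi (x + y).
Proof.
by apply/quo_piP; rewrite opprD addrACA; apply: sm_D; apply: quo_reprP.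
Qed.

Lemma quo_oppE x : quo_opp (quo_pi x) = quo_pi (- x).
Proof. by apply/quo_piP; rewrite -opprD; apply: sm_N; apply: quo_reprP. Qed.

Lemma quo_scaleE c x : quo_scale c (quo_pi x) = quo_pi (c *: x).
Proof. by apply/quo_piP; rewrite -scalerBr; apply: sm_Z; apply: quo_reprP. Qed.

Fact quo_addA : associative quo_add.
Proof.
elim/quo_piW=> x; elim/quo_piW=> y; elim/quo_piW=> z.
by rewrite !quo_addE addrA.
Qed.
Fact quo_addC : commutative quo_add.
Proof. by elim/quo_piW=> x; elim/quo_piW=> y; rewrite !quo_addE addrC. Qed.
Fact quo_add0 : left_id (quo_pi 0) quo_add.
Proof. by elim/quo_piW=> x; rewrite quo_addE add0r. Qed.
Fact quo_addN : left_inverse (quo_pi 0) quo_opp quo_add.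
Proof. by elim/quo_piW=> x; rewrite quo_oppE quo_addE addNr. Qed.

HB.instance Definition _ :=
  GRing.isZmodule.Build quo_mod quo_addA quo_addC quo_add0 quo_addN.

Fact quo_scaleA a b v : quo_scale a (quo_scale b v) = quo_scale (a * b) v.
Proof. by elim/quo_piW: v => v; rewrite !quo_scaleE scalerA. Qed.
Fact quo_scale1 : left_id 1 quo_scale.
Proof. by elim/quo_piW=> v; rewrite quo_scaleE scale1r. Qed.
Fact quo_scaleDr : right_distributive quo_scale +%R.
Proof.
move=> c; elim/quo_piW=> x; elim/quo_piW=> y.
by rewrite /GRing.add /= !(quo_scaleE, quo_addE) scalerDr.
Qed.
Fact quo_scaleDl v : {morph quo_scale^~ v : a b / a + b}.
Proof.
move=> a b; elim/quo_piW: v => v.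
by rewrite /GRing.add /= !(quo_scaleE, quo_addE) scalerDl.
Qed.

HB.instance Definition _ := GRing.Zmodule_isLmodule.Build K quo_mod
  quo_scaleA quo_scale1 quo_scaleDr quo_scaleDl.

Fact quo_pi_linear : linear quo_pi.
Proof. by move=> c x y; rewrite -quo_addE -quo_scaleE. Qed.
HB.instance Definition _ := GRing.isLinear.Build K V quo_mod _ quo_pi quo_pi_linear.

End SubQuotient.
Section Ideals.
Variable S : nzRingType.
Implicit Types c d : S -> Prop.

Definition right_ideal c :=
  [/\ c 0, forall x y, c x -> c y -> c (x + y) & forall x a, c x -> c (x * a)].

Definition left_ideal c :=
  [/\ c 0, forall x y, c x -> c y -> c (x + y) & forall a x, c x -> c (a * x)].

Definition right_noetherian := forall c, right_ideal c ->
  exists n (x : 'I_n -> S), (forall i, c (x i)) /\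
    forall y, c y -> exists a : 'I_n -> S, y = \sum_(i < n) x i * a i.

Definition left_noetherian := forall c, left_ideal c ->
  exists n (x : 'I_n -> S), (forall i, c (x i)) /\
    forall y, c y -> exists a : 'I_n -> S, y = \sum_(i < n) a i * x i.

Definition noetherian := left_noetherian /\ right_noetherian.

Record ideal := Ideal {
  id_in :> S -> Prop;
  id_left : left_ideal id_in;
  id_right : right_ideal id_in }.

Definition ideal_mul c d : S -> Prop := fun x =>
  exists n (a b : 'I_n -> S),
    [/\ forall i, c (a i), forall i, d (b i) & x = \sum_(i < n) a i * b i].

Fixpoint ideal_pow c n : S -> Prop :=
  if n is n'.+1 then ideal_mul (ideal_pow c n') c else fun=> True.

Definition right_artin_rees (s : ideal) :=
  forall c, right_ideal c -> exists n, forall x,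
    c x -> ideal_pow s n x -> ideal_mul c s x.

Lemma right_ideal_sum c n (x : 'I_n -> S) : right_ideal c ->
  (forall i, c (x i)) -> c (\sum_(i < n) x i).
Proof. by case=> c0 cD _ cx; elim/big_ind: _. Qed.

Lemma left_ideal_sum c n (x : 'I_n -> S) : left_ideal c ->
  (forall i, c (x i)) -> c (\sum_(i < n) x i).
Proof. by case=> c0 cD _ cx; elim/big_ind: _. Qed.

Lemma ideal_mul_add c d x y :
  ideal_mul c d x -> ideal_mul c d y -> ideal_mul c d (x + y).
Proof.
case=> [n [a [b [ca db ->]]]] [m [a' [b' [ca' db' ->]]]].
exists (n + m)%N.
exists (fun i => match split i with inl j => a j | inr j => a' j end).
exists (fun i => match split i with inl j => b j | inr j => b' j end).
split; try by move=> i; case: (split i).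
rewrite big_split_ord /=; congr (_ + _); apply: eq_bigr => i _.
  by case: split_ordP => j /eqP; rewrite (eq_lshift, eq_lrshift) // => /eqP ->.
case: split_ordP => j /eqP; rewrite ?eq_rlshift ?eq_rshift //.
by move=> /eqP ->.
Qed.

Lemma ideal_mul_0 c d : ideal_mul c d 0.
Proof.
exists 0%N, (fun=> 0), (fun=> 0); split; try by case.
by rewrite big_ord0.
Qed.

Lemma ideal_mul1 (c d : S -> Prop) x y : c x -> d y -> ideal_mul c d (x * y).
Proof.
by move=> cx dy; exists 1%N, (fun=> x), (fun=> y); rewrite big_ord1.
Qed.

Lemma ideal_mul_right c d : right_ideal d -> right_ideal (ideal_mul c d).
Proof.
move=> [d0 dD dM]; split; [exact: ideal_mul_0|exact: ideal_mul_add|].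
move=> x r [n [a [b [ca db ->]]]].
exists n, a, (fun i => b i * r); split=> // [i|]; first exact: dM.
by rewrite mulr_suml; apply: eq_bigr => i _; rewrite mulrA.
Qed.

Lemma ideal_mul_left c d : left_ideal c -> left_ideal (ideal_mul c d).
Proof.
move=> [c0 cD cM]; split; [exact: ideal_mul_0|exact: ideal_mul_add|].
move=> r x [n [a [b [ca db ->]]]].
exists n, (fun i => r * a i), b; split=> // [i|]; first exact: cM.
by rewrite mulr_sumr; apply: eq_bigr => i _; rewrite mulrA.
Qed.

Variable s : ideal.

Lemma ideal_pow_right n : right_ideal (ideal_pow s n).
Proof. by case: n => [//|n]; apply: ideal_mul_right; apply: id_right. Qed.

Lemma ideal_pow_left n : left_ideal (ideal_pow s n).
Proof. by elim: n => [//|n IH]; apply: ideal_mul_left. Qed.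

Lemma ideal_pow_mulr n x a : ideal_pow s n x -> ideal_pow s n (x * a).
Proof. by case: (ideal_pow_right n) => _ _; apply. Qed.

Lemma ideal_pow_mull n x a : ideal_pow s n x -> ideal_pow s n (a * x).
Proof. by case: (ideal_pow_left n) => _ _; apply. Qed.

Lemma ideal_pow_sum n m (x : 'I_m -> S) :
  (forall i, ideal_pow s n (x i)) -> ideal_pow s n (\sum_(i < m) x i).
Proof. by apply: right_ideal_sum; apply: ideal_pow_right. Qed.

Lemma ideal_pow_add n m x : ideal_pow s (n + m) x ->
  ideal_mul (ideal_pow s n) (ideal_pow s m) x.
Proof.
elim: m x => [|m IH] x.
  by rewrite addn0 -{2}[x]mulr1 => sx; apply: ideal_mul1.
rewrite addnS /= => -[p [a [b [ha hb ->]]]].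
elim/big_ind: _ => [||i _]; [exact: ideal_mul_0|exact: ideal_mul_add|].
have [q [c [d [hc hd ->]]]] := IH _ (ha i).
exists q, c, (fun j => d j * b i); split=> // [j|].
  exact: ideal_mul1.
by rewrite mulr_suml; apply: eq_bigr => j _; rewrite mulrA.
Qed.

Lemma ideal_pow_leq n m x : (n <= m)%N -> ideal_pow s m x -> ideal_pow s n x.
Proof.
move=> /subnKC <- /ideal_pow_add [p [a [b [ha hb ->]]]].
by apply: ideal_pow_sum => i; apply: ideal_pow_mulr.
Qed.

End Ideals.

(* Right modules are left modules over the converse ring *)

Definition ract (S : nzRingType) (M : lmodType S^c) (m : M) (a : S) : M :=
  (a : S^c) *: m.
Notation "m *> a" := (ract m a) (at level 40, left associativity) : ring_scope.

Section RightModules.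
Variable S : nzRingType.
Implicit Types (M N : lmodType S^c) (a b : S).

Lemma ractM M (m : M) a b : m *> (a * b) = m *> a *> b.
Proof. by rewrite /ract scalerA. Qed.
Lemma ract1 M (m : M) : m *> 1 = m.
Proof. exact: scale1r. Qed.
Lemma ract0 M (m : M) : m *> 0 = 0.
Proof. exact: scale0r. Qed.
Lemma ractD M (m : M) a b : m *> (a + b) = m *> a + m *> b.
Proof. exact: scalerDl. Qed.
Lemma ractDl M (m n : M) a : (m + n) *> a = m *> a + n *> a.
Proof. exact: scalerDr. Qed.
Lemma ract0l M a : (0 : M) *> a = 0.
Proof. exact: scaler0. Qed.
Lemma ractNl M (m : M) a : (- m) *> a = - (m *> a).
Proof. exact: scalerN. Qed.
Lemma ractBl M (m n : M) a : (m - n) *> a = m *> a - n *> a.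
Proof. exact: scalerBr. Qed.
Lemma ract_sum M (m : M) n (a : 'I_n -> S) :
  m *> (\sum_(i < n) a i) = \sum_(i < n) m *> a i.
Proof. exact: scaler_suml. Qed.
Lemma linear_ract M N (f : {linear M -> N}) m a : f (m *> a) = f m *> a.
Proof. by rewrite /ract linearZ. Qed.

Definition fin_gen M := exists n (x : 'I_n -> M),
  forall y, exists a : 'I_n -> S, y = \sum_(i < n) x i *> a i.

Variable s : ideal S.

(* Gamma_s(M) = colim_n Hom_S(S/s^n, M), identified with the set of values at 1:
   the elements of M killed by some power of s *)
Definition Gamma M (m : M) : Prop :=
  exists n, forall x, ideal_pow s n x -> m *> x = 0.

Definition torsion M : Prop := forall m : M, Gamma m.

(* [mod_torsion P Q] for submodules P, Q of M: the module P / (P :&: Q) is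
   s-torsion; in particular M / Q is torsion iff [mod_torsion (fun=> True) Q],
   and P is torsion iff [mod_torsion P (fun m => m = 0)] *)
Definition mod_torsion M (P Q : M -> Prop) : Prop :=
  forall m, P m -> exists n, forall x, ideal_pow s n x -> Q (m *> x).

Lemma mod_torsion_sub M (P Q : M -> Prop) : (forall m, P m -> Q m) ->
  (forall m a, P m -> P (m *> a)) -> mod_torsion P Q.
Proof. by move=> PQ Pa m Pm; exists 0%N => x _; apply/PQ/Pa. Qed.

Lemma mod_torsion_weak M (P P' Q Q' : M -> Prop) :
  (forall m, P' m -> P m) -> (forall m, Q m -> Q' m) ->
  mod_torsion P Q -> mod_torsion P' Q'.
Proof.
move=> h h' t m /h /t [n hn]; exists n => x sx; apply: h'; exact: hn.
Qed.

Lemma mod_torsionI M (P Q Q' : M -> Prop) :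
  mod_torsion P Q -> mod_torsion P Q' -> mod_torsion P (fun m => Q m /\ Q' m).
Proof.
move=> t t' m Pm; have [n hn] := t _ Pm; have [n' hn'] := t' _ Pm.
exists (maxn n n') => x sx; split.
- by apply: hn; apply: ideal_pow_leq sx; apply: leq_maxl.
- by apply: hn'; apply: ideal_pow_leq sx; apply: leq_maxr.
Qed.

Hypothesis noeS : right_noetherian S.

(* torsion modules are closed under extensions *)
Lemma mod_torsion_trans M (P Q T : M -> Prop) :
  T 0 -> (forall x y, T x -> T y -> T (x + y)) ->
  mod_torsion P Q -> mod_torsion Q T -> mod_torsion P T.
Proof.
move=> T0 TD PQ QT m Pm; have [n hn] := PQ _ Pm.
have [p [x [sx gx]]] := noeS (ideal_pow_right s n).
have [l hl] : exists l, forall i y, ideal_pow s l y -> T (m *> x i *> y).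
  have /choice [f hf] : forall i, exists l, forall y, ideal_pow s l y ->
      T (m *> x i *> y) by move=> i; apply: QT; apply: hn.
  exists (\max_(i < p) f i)%N => i y sy; apply: hf; apply: ideal_pow_leq sy.
  exact: leq_bigmax.
exists (n + l)%N => y /ideal_pow_add [q [a [b [ha hb ->]]]].
rewrite ract_sum; elim/big_ind: _ => // i _.
have [c ->] := gx _ (ha i).
rewrite mulr_suml ract_sum; elim/big_ind: _ => // j _.
by rewrite -mulrA ractM; apply: hl; apply: ideal_pow_mull.
Qed.

End RightModules.

Section TorsionModules.
Variables (S : nzRingType) (s : ideal S) (M : lmodType S^c) (P : submod M).

Lemma torsion_quo : torsion s (quo_mod P) <-> mod_torsion s (fun=> True) P.
Proof.
split=> [t m _|t]; last first.
  elim/quo_piW=> m; have [n hn] := t m I; exists n => x /hn Px.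
  by rewrite /ract -linearZ /= -(linear0 (quo_pi P)); apply/quo_piP; rewrite subr0.
have [n hn] := t (quo_pi P m); exists n => x /hn.
rewrite /ract -linearZ /= -(linear0 (quo_pi P)) => /quo_piP.
by rewrite subr0.
Qed.

Lemma torsion_sub : torsion s (sub_mod P) <-> mod_torsion s P (fun m => m = 0).
Proof.
split=> [t m Pm|t [m Pm]].
  have [n hn] := t (SubMod (asboolT Pm)); exists n => x /hn.
  by move/(congr1 val).
have [n hn] := t m (asboolW Pm); exists n => x /hn h; exact: val_inj.
Qed.

End TorsionModules.

Record lincat (k : fieldType) := LinCat {
  obj :> Type;
  mor : obj -> obj -> lmodType k;
  idm : forall X, mor X X;
  mcomp : forall X Y Z, mor Y Z -> mor X Y -> mor X Z;
  mcompA : forall X Y Z T (h : mor Z T) (g : mor Y Z) (f : mor X Y),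
    mcomp h (mcomp g f) = mcomp (mcomp h g) f;
  mcomp1l : forall X Y (f : mor X Y), mcomp (idm Y) f = f;
  mcomp1r : forall X Y (f : mor X Y), mcomp f (idm X) = f;
  mcompPl : forall X Y Z a (g g' : mor Y Z) (f : mor X Y),
    mcomp (a *: g + g') f = a *: mcomp g f + mcomp g' f;
  mcompPr : forall X Y Z a (g : mor Y Z) (f f' : mor X Y),
    mcomp g (a *: f + f') = a *: mcomp g f + mcomp g f' }.

Arguments mor {k C} : rename.
Arguments idm {k C} : rename.
Arguments mcomp {k C X Y Z} : rename.

Notation "g \oc f" := (mcomp g f) (at level 40, left associativity) : ring_scope.

Section LinCatTheory.
Variables (k : fieldType) (C : lincat k).
Implicit Types X Y Z W K J : C.

Lemma mcomp0l X Y Z (f : mor X Y) : (0 : mor Y Z) \oc f = 0.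
Proof.
have := mcompPl 1 0 (0 : mor Y Z) f; rewrite !scale1r addr0 => h.
by apply: (addIr ((0 : mor Y Z) \oc f)); rewrite -h add0r.
Qed.

Lemma mcomp0r X Y Z (g : mor Y Z) : g \oc (0 : mor X Y) = 0.
Proof.
have := mcompPr 1 g (0 : mor X Y) 0; rewrite !scale1r addr0 => h.
by apply: (addIr (g \oc (0 : mor X Y))); rewrite -h add0r.
Qed.

Definition mono X Y (f : mor X Y) :=
  forall W (u v : mor W X), f \oc u = f \oc v -> u = v.

Definition epi X Y (f : mor X Y) :=
  forall W (u v : mor Y W), u \oc f = v \oc f -> u = v.

Definition is_kernel K X Y (i : mor K X) (g : mor X Y) :=
  g \oc i = 0 /\
  forall W (u : mor W X), g \oc u = 0 -> exists! v : mor W K, i \oc v = u.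

(* exactness of X --f--> Y --g--> Z: f factors as an epimorphism followed by the
   kernel of g, i.e. the image of f is the kernel of g *)
Definition exact_at X Y Z (f : mor X Y) (g : mor Y Z) :=
  exists K (i : mor K Y) (e : mor X K), [/\ is_kernel i g, epi e & f = i \oc e].

Definition injective_obj J :=
  forall X Y (m : mor X Y), mono m ->
  forall f : mor X J, exists h : mor Y J, h \oc m = f.

Lemma exact_comp X Y Z (f : mor X Y) (g : mor Y Z) : exact_at f g -> g \oc f = 0.
Proof. by case=> K [i [e [[gi _] _ ->]]]; rewrite mcompA gi mcomp0l. Qed.

Record cocomplex := Cocomplex {
  cx_obj :> nat -> C;
  cx_d : forall n, mor (cx_obj n) (cx_obj n.+1);
  cx_dd : forall n, cx_d n.+1 \oc cx_d n = 0 }.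

(* exact sequences 0 -> Y -> J^0 -> J^1 -> ... with every J^n injective *)
Record injres (Y : C) := InjRes {
  ir_cx :> cocomplex;
  ir_aug : mor Y (ir_cx 0%N);
  ir_inj : forall n, injective_obj (ir_cx n);
  ir_mono : mono ir_aug;
  ir_exact0 : exact_at ir_aug (cx_d ir_cx 0);
  ir_exact : forall n, exact_at (cx_d ir_cx n) (cx_d ir_cx n.+1) }.

Record cx_map (D E : cocomplex) := CxMap {
  cm_fun :> forall n, mor (D n) (E n);
  cm_comm : forall n, cm_fun n.+1 \oc cx_d D n = cx_d E n \oc cm_fun n }.

End LinCatTheory.

Arguments cx_d {k C} : rename.

Section Cohomology.
Variable k : fieldType.

Record kcomplex := KComplex {
  kc :> nat -> lmodType k;
  kd : forall n, {linear kc n -> kc n.+1};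
  kdd : forall n x, kd n.+1 (kd n x) = 0 }.

Record kc_map (V W : kcomplex) := KcMap {
  km_fun :> forall n, {linear V n -> W n};
  km_comm : forall n x, km_fun n.+1 (kd V n x) = kd W n (km_fun n x) }.

Section Groups.
Variable V : kcomplex.

Fact cocycles_0 n : kd V n 0 = 0. Proof. exact: linear0. Qed.
Fact cocycles_D n x y : kd V n x = 0 -> kd V n y = 0 -> kd V n (x + y) = 0.
Proof. by move=> hx hy; rewrite linearD hx hy addr0. Qed.
Fact cocycles_Z n c x : kd V n x = 0 -> kd V n (c *: x) = 0.
Proof. by move=> hx; rewrite linearZ /= hx scaler0. Qed.

Definition cocycles n : submod (V n) :=
  Submod (@cocycles_0 n) (@cocycles_D n) (@cocycles_Z n).

Definition is_coboundary n : V n -> Prop :=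
  if n is n'.+1 return V n -> Prop then fun x => exists y, x = kd V n' y
  else fun x => x = 0.

Fact coboundary_0 n : is_coboundary (0 : V n).
Proof. by case: n => [//|n]; exists 0; rewrite linear0. Qed.
Fact coboundary_D n (x y : V n) :
  is_coboundary x -> is_coboundary y -> is_coboundary (x + y).
Proof.
case: n x y => [|n] x y /=; first by move=> -> ->; rewrite addr0.
by move=> [u ->] [v ->]; exists (u + v); rewrite linearD.
Qed.
Fact coboundary_Z n c (x : V n) : is_coboundary x -> is_coboundary (c *: x).
Proof.
case: n x => [|n] x /=; first by move=> ->; rewrite scaler0.
by move=> [u ->]; exists (c *: u); rewrite linearZ.
Qed.

Definition coboundary_val n (x : sub_mod (cocycles n)) := is_coboundary (val x).

Fact coboundary_val_0 n : @coboundary_val n 0.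
Proof. by rewrite /coboundary_val raddf0; apply: coboundary_0. Qed.
Fact coboundary_val_D n x y :
  @coboundary_val n x -> coboundary_val y -> coboundary_val (x + y).
Proof. by rewrite /coboundary_val raddfD; apply: coboundary_D. Qed.
Fact coboundary_val_Z n c x : @coboundary_val n x -> coboundary_val (c *: x).
Proof. by rewrite /coboundary_val linearZ; apply: coboundary_Z. Qed.

Definition coboundaries n : submod (sub_mod (cocycles n)) :=
  Submod (@coboundary_val_0 n) (@coboundary_val_D n) (@coboundary_val_Z n).

Definition cohomology n : lmodType k := quo_mod (coboundaries n).

Definition coho_class n (x : sub_mod (cocycles n)) : cohomology n :=
  quo_pi (coboundaries n) x.

Lemma coho_class_eq n x y :
  coho_class x = coho_class y <-> @is_coboundary n (val x - val y).
Proof. exact: quo_piP. Qed.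

End Groups.

Section Map.
Variables (V W : kcomplex) (f : kc_map V W) (n : nat).

Fact cocycle_map_subproof (x : sub_mod (cocycles V n)) :
  sm_pred (cocycles W n) (f n (val x)).
Proof.
by apply/asboolP; rewrite /= -km_comm (asboolW (sub_in x)) linear0.
Qed.

Definition cocycle_map (x : sub_mod (cocycles V n)) : sub_mod (cocycles W n) :=
  SubMod (cocycle_map_subproof x).

Lemma coboundary_map x : is_coboundary x -> is_coboundary (f n x).
Proof.
case: n x => [|m] x /=; first by move=> ->; rewrite linear0.
by move=> [y ->]; exists (f m y); rewrite km_comm.
Qed.

(* the map induced on cohomology; its value on the class of z is the class of
   f(z), see [coho_mapE] *)
Definition coho_map (q : cohomology V n) : cohomology W n :=
  coho_class (cocycle_map (crepr q)).

Lemma coho_mapE x : coho_map (coho_class x) = coho_class (cocycle_map x).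
Proof.
apply/coho_class_eq; rewrite /= -linearB; apply: coboundary_map.
exact: (@quo_reprP _ _ (coboundaries V n) x).
Qed.

Fact coho_map_linear : linear coho_map.
Proof.
move=> a; elim/quo_piW=> x; elim/quo_piW=> y.
rewrite -linearP -!/(coho_class _) !coho_mapE -linearP.
by congr (coho_class _); apply: val_inj; rewrite /= linearP.
Qed.

HB.instance Definition _ :=
  GRing.isLinear.Build k (cohomology V n) (cohomology W n) _ coho_map coho_map_linear.

End Map.
End Cohomology.

Section Ext.
Variables (k : fieldType) (C : lincat k) (X : C).

Section HomComplex.
Variable J : cocomplex C.

Definition postcomp Y Z (g : mor Y Z) (f : mor X Y) : mor X Z := g \oc f.

Fact postcomp_linear Y Z (g : mor Y Z) : linear (postcomp g).
Proof. by move=> a f f'; apply: mcompPr. Qed.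
HB.instance Definition _ Y Z (g : mor Y Z) :=
  GRing.isLinear.Build k (mor X Y) (mor X Z) _ (postcomp g) (postcomp_linear g).

Fact hom_complex_dd n (f : mor X (J n)) :
  postcomp (cx_d J n.+1) (postcomp (cx_d J n) f) = 0.
Proof. by rewrite /postcomp mcompA cx_dd mcomp0l. Qed.

Definition hom_complex : kcomplex k :=
  @KComplex k (fun n => mor X (J n)) (fun n => postcomp (cx_d J n)) hom_complex_dd.

End HomComplex.

Fact hom_complex_map_comm D E (phi : cx_map D E) n (f : mor X (D n)) :
  postcomp (phi n.+1) (postcomp (cx_d D n) f) =
  postcomp (cx_d E n) (postcomp (phi n) f).
Proof. by rewrite /postcomp !mcompA cm_comm. Qed.

Definition hom_complex_map D E (phi : cx_map D E) :
    kc_map (hom_complex D) (hom_complex E) :=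
  @KcMap _ (hom_complex D) (hom_complex E) (fun n => postcomp (phi n))
    (hom_complex_map_comm phi).

(* Ext^i(X, Y) computed with the injective resolution J of Y *)
Definition Ext Y (J : injres Y) i : lmodType k := cohomology (hom_complex J) i.

End Ext.

Record comparison (k : fieldType) (C : lincat k) (Y : C) (D : cocomplex C)
    (aug : mor Y (D 0%N)) (J : injres Y) := Comparison {
  cmp_map :> cx_map D J;
  cmp_aug : cmp_map 0%N \oc aug = ir_aug J }.

Record linfunctor (k : fieldType) (C D : lincat k) := LinFunctor {
  fobj :> C -> D;
  fmap : forall X Y, mor X Y -> mor (fobj X) (fobj Y);
  fmap1 : forall X, fmap (idm X) = idm (fobj X);
  fmapM : forall X Y Z (g : mor Y Z) (f : mor X Y),
    fmap (g \oc f) = fmap g \oc fmap f;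
  fmapP : forall X Y a (f g : mor X Y), fmap (a *: f + g) = a *: fmap f + fmap g }.

Arguments fmap {k C D} F {X Y} : rename.

Section Functors.
Variables (k : fieldType).

Section Image.
Variables (C D : lincat k) (F : linfunctor C D) (J : cocomplex C).

Lemma fmap0 (X Y : C) : fmap F (0 : mor X Y) = 0.
Proof.
have := fmapP F 1 (0 : mor X Y) 0; rewrite !scale1r addr0 => h.
by apply: (addIr (fmap F (0 : mor X Y))); rewrite -h add0r.
Qed.

Fact fmap_cx_dd n : fmap F (cx_d J n.+1) \oc fmap F (cx_d J n) = 0.
Proof. by rewrite -fmapM cx_dd fmap0. Qed.

Definition fmap_cx : cocomplex D := @Cocomplex k D (fun n => F (J n))
  (fun n => fmap F (cx_d J n)) fmap_cx_dd.

End Image.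

Variables (C D E : lincat k) (G : linfunctor D E) (F : linfunctor C D).

Fact fcomp1 X : fmap G (fmap F (idm X)) = idm (G (F X)).
Proof. by rewrite !fmap1. Qed.
Fact fcompM X Y Z (g : mor Y Z) (f : mor X Y) :
  fmap G (fmap F (g \oc f)) = fmap G (fmap F g) \oc fmap G (fmap F f).
Proof. by rewrite !fmapM. Qed.
Fact fcompP X Y a (f g : mor X Y) :
  fmap G (fmap F (a *: f + g)) = a *: fmap G (fmap F f) + fmap G (fmap F g).
Proof. by rewrite !fmapP. Qed.

Definition fcomp : linfunctor C E := LinFunctor fcomp1 fcompM fcompP.

End Functors.

(* chain maps from the image of I under F to J that lift the identity of F Y *)
Definition res_comparison (k : fieldType) (C D : lincat k) (F : linfunctor C D)
    (Y : C) (I : injres Y) (J : injres (F Y)) :=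
  @comparison k D (F Y) (fmap_cx F I) (fmap F (ir_aug I)) J.

Section ScalarAction.
Variables (k : fieldType) (S : algType k) (M : lmodType S^c).

Lemma ract_algC (m : M) (c : k) (a : S) : m *> c%:A *> a = m *> a *> c%:A.
Proof. by rewrite -!ractM mulr_algl mulr_algr. Qed.

Lemma ract_algM (m : M) (c d : k) : m *> (c * d)%:A = m *> c%:A *> d%:A.
Proof. by rewrite -ractM mulr_algr scalerA mulrC. Qed.

End ScalarAction.

Section ModuleHom.
Variables (k : fieldType) (S : algType k).
Implicit Types N M : lmodType S^c.

Record modhom N M := ModHom { mh_fun :> N -> M; mh_linear : linear mh_fun }.

HB.instance Definition _ N M (f : modhom N M) :=
  GRing.isLinear.Build S^c N M _ (mh_fun f) (mh_linear f).
HB.instance Definition _ N M := gen_eqMixin (modhom N M).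
HB.instance Definition _ N M := gen_choiceMixin (modhom N M).

Lemma modhomP N M (f g : modhom N M) : f =1 g -> f = g.
Proof.
case: f g => f fP [g gP] /= /funext efg; subst g.
by rewrite (Prop_irrelevance fP gP).
Qed.

Lemma mh_ract N M (f : modhom N M) n a : f (n *> a) = f n *> a.
Proof. exact: linear_ract. Qed.

Section Ops.
Variables (N M : lmodType S^c).
Implicit Types f g : modhom N M.

Fact mh_zero_linear : linear (fun _ : N => 0 : M).
Proof. by move=> a x y; rewrite scaler0 addr0. Qed.
Definition mh_zero := ModHom mh_zero_linear.

Fact mh_add_linear f g : linear (fun n => f n + g n).
Proof. by move=> a x y; rewrite !linearP scalerDr addrACA. Qed.
Definition mh_add f g := ModHom (mh_add_linear f g).

Fact mh_opp_linear f : linear (fun n => - f n).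
Proof. by move=> a x y; rewrite linearP opprD scalerN. Qed.
Definition mh_opp f := ModHom (mh_opp_linear f).

Fact mh_scale_linear (c : k) f : linear (fun n => f n *> c%:A).
Proof.
move=> a x y; rewrite linearP ractDl; congr (_ + _).
exact: (esym (ract_algC (f x) c a)).
Qed.
Definition mh_scale c f := ModHom (mh_scale_linear c f).

Fact mh_addA : associative mh_add.
Proof. by move=> f g h; apply: modhomP => n; apply: addrA. Qed.
Fact mh_addC : commutative mh_add.
Proof. by move=> f g; apply: modhomP => n; apply: addrC. Qed.
Fact mh_add0 : left_id mh_zero mh_add.
Proof. by move=> f; apply: modhomP => n; apply: add0r. Qed.
Fact mh_addN : left_inverse mh_zero mh_opp mh_add.
Proof. by move=> f; apply: modhomP => n; apply: addNr. Qed.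

HB.instance Definition _ :=
  GRing.isZmodule.Build (modhom N M) mh_addA mh_addC mh_add0 mh_addN.

Fact mh_scaleA a b f : mh_scale a (mh_scale b f) = mh_scale (a * b) f.
Proof. by apply: modhomP => n; rewrite /= mulrC ract_algM. Qed.
Fact mh_scale1 : left_id 1 mh_scale.
Proof. by move=> f; apply: modhomP => n; rewrite /= scale1r ract1. Qed.
Fact mh_scaleDr : right_distributive mh_scale +%R.
Proof. by move=> c f g; apply: modhomP => n; apply: ractDl. Qed.
Fact mh_scaleDl f : {morph mh_scale^~ f : a b / a + b}.
Proof. by move=> a b; apply: modhomP => n; rewrite /= scalerDl ractD. Qed.

HB.instance Definition _ := GRing.Zmodule_isLmodule.Build k (modhom N M)
  mh_scaleA mh_scale1 mh_scaleDr mh_scaleDl.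

End Ops.

Fact mh_id_linear M : linear (id : M -> M). Proof. by []. Qed.
Definition mh_id M : modhom M M := ModHom (mh_id_linear (M := M)).

Fact mh_comp_linear N M L (g : modhom M L) (f : modhom N M) : linear (g \o f).
Proof. by move=> a x y; rewrite /= !linearP. Qed.
Definition mh_comp N M L (g : modhom M L) (f : modhom N M) : modhom N L :=
  ModHom (mh_comp_linear g f).

Fact mh_compA N M L T (h : modhom L T) (g : modhom M L) (f : modhom N M) :
  mh_comp h (mh_comp g f) = mh_comp (mh_comp h g) f.
Proof. exact: modhomP. Qed.
Fact mh_comp1l N M (f : modhom N M) : mh_comp (mh_id M) f = f.
Proof. exact: modhomP. Qed.
Fact mh_comp1r N M (f : modhom N M) : mh_comp f (mh_id N) = f.
Proof. exact: modhomP. Qed.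
Fact mh_compPl N M L (c : k) (g g' : modhom M L) (f : modhom N M) :
  mh_comp (c *: g + g') f = c *: mh_comp g f + mh_comp g' f.
Proof. exact: modhomP. Qed.
Fact mh_compPr N M L (c : k) (g : modhom M L) (f f' : modhom N M) :
  mh_comp g (c *: f + f') = c *: mh_comp g f + mh_comp g f'.
Proof.
apply: modhomP => n; rewrite /= linearD; congr (_ + _).
exact: (mh_ract g (f n) c%:A).
Qed.

Definition Mod : lincat k :=
  @LinCat k (lmodType S^c) modhom mh_id mh_comp mh_compA mh_comp1l mh_comp1r
    mh_compPl mh_compPr.

End ModuleHom.

(* The Serre quotient of the category of right S-modules by the s-torsion
   modules. A morphism N -> M is the class of a linear map N' -> M / M', where
   N' and M' are submodules of N and M with N / N' and M' torsion:
     Hom(N, M) = colim_(N', M') Hom_S(N', M / M').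
   Such a map f is encoded by the submodule {(n, m) | n \in N', f n = m + M'}
   of N x M, whose domain is N' and whose fibre over 0 is M'. Maps
   N' -> M / M' and N'' -> M / M'' become equal in the colimit iff the
   intersection of the corresponding submodules of N x M has again a domain
   with torsion cokernel in N.
   S is right noetherian so that the torsion modules form a Serre subcategory
   (see [mod_torsion_trans]), as needed to compose morphisms. *)

Section SerreQuotient.
Variables (k : fieldType) (S : algType k) (s : ideal S).

Section Frac.
Variables N M : lmodType S^c.

Record frac := Frac {
  fr_rel :> N -> M -> Prop;
  fr_0 : fr_rel 0 0;
  fr_D : forall n m n' m', fr_rel n m -> fr_rel n' m' -> fr_rel (n + n') (m + m');
  fr_Z : forall n m a, fr_rel n m -> fr_rel (n *> a) (m *> a);
  fr_dom : mod_torsion s (fun=> True) (fun n => exists m, fr_rel n m);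
  fr_fib : mod_torsion s (fr_rel 0) (fun m => m = 0) }.

Definition frac_eq (f g : frac) : Prop :=
  mod_torsion s (fun=> True) (fun n => exists m, f n m /\ g n m).

Lemma fr_N (f : frac) n m : f n m -> f (- n) (- m).
Proof.
move=> /(fr_Z (-1)).
by rewrite /ract; have -> : (-1 : S) = (-1 : S^c) by []; rewrite !scaleN1r.
Qed.

Lemma fr_B (f : frac) n m n' m' : f n m -> f n' m' -> f (n - n') (m - m').
Proof. by move=> h /fr_N; apply: fr_D. Qed.

Lemma frac_eqI (f g : frac) :
  (forall n m, f n m -> exists m', f n m' /\ g n m') -> frac_eq f g.
Proof.
move=> h; apply: mod_torsion_weak (fr_dom f) => // n [m /h]; exact.
Qed.

End Frac.

Hypothesis noeS : right_noetherian S.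

Lemma frac_eq_equiv N M : equivalence_prop (@frac_eq N M).
Proof.
split.
- by move=> f; apply: frac_eqI => n m fnm; exists m.
- by move=> f g; apply: mod_torsion_weak => // n [m [h h']]; exists m.
move=> f g h fg gh.
apply: (mod_torsion_trans noeS _ _ (mod_torsionI fg gh)).
- by exists 0; split; apply: fr_0.
- by move=> x y [m [? ?]] [m' [? ?]]; exists (m + m'); split; apply: fr_D.
move=> n [[m [fm gm]] [m' [gm' hm']]].
have gd : g 0 (m - m') by rewrite -(subrr n); apply: fr_B.
have [l hl] := fr_fib gd; exists l => x /hl.
rewrite ractBl => /eqP; rewrite subr_eq0 => /eqP e.
by exists (m *> x); split; [|rewrite e]; apply: fr_Z.
Qed.

Section OfHom.
Variables (N M : lmodType S^c) (f : modhom N M).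

Definition frac_hom_rel n m := m = f n.
Fact frac_hom_0 : frac_hom_rel 0 0. Proof. exact/esym/linear0. Qed.
Fact frac_hom_D n m n' m' : frac_hom_rel n m -> frac_hom_rel n' m' ->
  frac_hom_rel (n + n') (m + m').
Proof. by rewrite /frac_hom_rel => -> ->; rewrite linearD. Qed.
Fact frac_hom_Z n m a : frac_hom_rel n m -> frac_hom_rel (n *> a) (m *> a).
Proof. by rewrite /frac_hom_rel => ->; rewrite mh_ract. Qed.
Fact frac_hom_dom : mod_torsion s (fun=> True) (fun n => exists m, frac_hom_rel n m).
Proof. by move=> n _; exists 0%N => x _; exists (f (n *> x)). Qed.
Fact frac_hom_fib : mod_torsion s (frac_hom_rel 0) (fun m => m = 0).
Proof. by move=> m ->; exists 0%N => x _; rewrite linear0 ract0l. Qed.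
Definition frac_hom : frac N M :=
  Frac frac_hom_0 frac_hom_D frac_hom_Z frac_hom_dom frac_hom_fib.

End OfHom.

Section Ops.
Variables N M : lmodType S^c.
Implicit Types f g : frac N M.

Definition frac_add_rel f g n m :=
  exists m1 m2, [/\ f n m1, g n m2 & m = m1 + m2].
Fact frac_add_0 f g : frac_add_rel f g 0 0.
Proof. by exists 0, 0; split; rewrite ?addr0 //; apply: fr_0. Qed.
Fact frac_add_D f g n m n' m' : frac_add_rel f g n m -> frac_add_rel f g n' m' ->
  frac_add_rel f g (n + n') (m + m').
Proof.
move=> [a [b [fa gb ->]]] [a' [b' [fa' gb' ->]]].
by exists (a + a'), (b + b'); rewrite addrACA; split=> //; apply: fr_D.
Qed.
Fact frac_add_Z f g n m a : frac_add_rel f g n m ->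
  frac_add_rel f g (n *> a) (m *> a).
Proof.
move=> [b [c [fb gc ->]]]; exists (b *> a), (c *> a).
by rewrite ractDl; split=> //; apply: fr_Z.
Qed.
Fact frac_add_dom f g :
  mod_torsion s (fun=> True) (fun n => exists m, frac_add_rel f g n m).
Proof.
apply: mod_torsion_weak (mod_torsionI (fr_dom f) (fr_dom g)) => //.
by move=> n [[a fa] [b gb]]; exists (a + b), a, b.
Qed.
Fact frac_add_fib f g : mod_torsion s (frac_add_rel f g 0) (fun m => m = 0).
Proof.
move=> m [a [b [/fr_fib [p hp] /fr_fib [q hq] ->]]]; exists (maxn p q) => x sx.
rewrite ractDl hp ?hq ?addr0 //; apply: ideal_pow_leq sx.
  exact: leq_maxr.
exact: leq_maxl.
Qed.
Definition frac_add f g : frac N M :=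
  Frac (frac_add_0 f g) (@frac_add_D f g) (@frac_add_Z f g)
    (@frac_add_dom f g) (@frac_add_fib f g).

Definition frac_scale_rel (c : k) f n m := exists m', f n m' /\ m = m' *> c%:A.
Fact frac_scale_0 c f : frac_scale_rel c f 0 0.
Proof. by exists 0; rewrite ract0l; split=> //; apply: fr_0. Qed.
Fact frac_scale_D c f n m n' m' : frac_scale_rel c f n m ->
  frac_scale_rel c f n' m' -> frac_scale_rel c f (n + n') (m + m').
Proof.
move=> [a [fa ->]] [a' [fa' ->]]; exists (a + a').
by rewrite ractDl; split=> //; apply: fr_D.
Qed.
Fact frac_scale_Z c f n m a : frac_scale_rel c f n m ->
  frac_scale_rel c f (n *> a) (m *> a).
Proof.
by move=> [b [fb ->]]; exists (b *> a); rewrite ract_algC; split=> //; apply: fr_Z.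
Qed.
Fact frac_scale_dom c f :
  mod_torsion s (fun=> True) (fun n => exists m, frac_scale_rel c f n m).
Proof.
by apply: mod_torsion_weak (fr_dom f) => // n [m fm]; exists (m *> c%:A), m.
Qed.
Fact frac_scale_fib c f : mod_torsion s (frac_scale_rel c f 0) (fun m => m = 0).
Proof.
move=> m [a [/fr_fib [p hp] ->]]; exists p => x sx.
by rewrite ract_algC hp // ract0l.
Qed.
Definition frac_scale c f : frac N M :=
  Frac (frac_scale_0 c f) (@frac_scale_D c f) (@frac_scale_Z c f)
    (@frac_scale_dom c f) (@frac_scale_fib c f).

Lemma frac_add_eq f f' g g' : frac_eq f f' -> frac_eq g g' ->
  frac_eq (frac_add f g) (frac_add f' g').
Proof.
move=> ef eg; apply: mod_torsion_weak (mod_torsionI ef eg) => //.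
move=> n [[a [fa fa']] [b [gb gb']]].
by exists (a + b); split; exists a, b.
Qed.

Lemma frac_scale_eq c f f' : frac_eq f f' ->
  frac_eq (frac_scale c f) (frac_scale c f').
Proof.
apply: mod_torsion_weak => // n [m [h h']].
by exists (m *> c%:A); split; exists m.
Qed.

End Ops.

Section Comp.
Variables (N M L : lmodType S^c) (g : frac M L) (f : frac N M).

Definition frac_comp_rel n l := exists m, f n m /\ g m l.
Fact frac_comp_0 : frac_comp_rel 0 0.
Proof. by exists 0; split; apply: fr_0. Qed.
Fact frac_comp_D n m n' m' : frac_comp_rel n m -> frac_comp_rel n' m' ->
  frac_comp_rel (n + n') (m + m').
Proof.
by move=> [a [fa ga]] [a' [fa' ga']]; exists (a + a'); split; apply: fr_D.
Qed.
Fact frac_comp_Z n m a : frac_comp_rel n m -> frac_comp_rel (n *> a) (m *> a).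
Proof. by move=> [b [fb gb]]; exists (b *> a); split; apply: fr_Z. Qed.
Fact frac_comp_dom :
  mod_torsion s (fun=> True) (fun n => exists m, frac_comp_rel n m).
Proof.
apply: (mod_torsion_trans noeS _ _ (fr_dom f)).
- by exists 0; apply: frac_comp_0.
- by move=> x y [m h] [m' h']; exists (m + m'); apply: frac_comp_D.
move=> n [m fm]; have [p hp] := fr_dom g (m := m) I.
exists p => x /hp [l gl]; exists l, (m *> x); split=> //; exact: fr_Z.
Qed.
Fact frac_comp_fib : mod_torsion s (frac_comp_rel 0) (fun m => m = 0).
Proof.
apply: (mod_torsion_trans noeS (Q := g 0) _ _ _ (@fr_fib _ _ g)).
- by [].
- by move=> x y -> ->; rewrite addr0.
move=> l [m [/fr_fib [p hp] gl]]; exists p => x /hp mx.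
by rewrite -mx; apply: fr_Z.
Qed.
Definition frac_comp : frac N L :=
  Frac frac_comp_0 frac_comp_D frac_comp_Z frac_comp_dom frac_comp_fib.

End Comp.

Lemma frac_comp_eq N M L (g g' : frac M L) (f f' : frac N M) :
  frac_eq g g' -> frac_eq f f' -> frac_eq (frac_comp g f) (frac_comp g' f').
Proof.
move=> eg ef; apply: (mod_torsion_trans noeS _ _ ef).
- by exists 0; split; apply: frac_comp_0.
- by move=> x y [m [? ?]] [m' [? ?]]; exists (m + m'); split; apply: frac_comp_D.
move=> n [m [fm fm']]; have [p hp] := eg m I.
exists p => x /hp [l [gl gl']]; exists l.
by split; exists (m *> x); split=> //; apply: fr_Z.
Qed.

Definition qhom (_ : right_noetherian S) N M : Type := cquot (@frac_eq N M).
Local Notation Q := (qhom noeS).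
HB.instance Definition _ (h : right_noetherian S) N M := gen_eqMixin (qhom h N M).
HB.instance Definition _ (h : right_noetherian S) N M :=
  gen_choiceMixin (qhom h N M).

Definition qclass N M (f : frac N M) : Q N M := cpi (@frac_eq N M) f.
Definition qrepr N M (q : Q N M) : frac N M := crepr q.

Lemma qclassP N M (f g : frac N M) : qclass f = qclass g <-> frac_eq f g.
Proof. exact: (cpiP (frac_eq_equiv N M)). Qed.

Lemma qclassW N M (P : Q N M -> Prop) : (forall f, P (qclass f)) -> forall q, P q.
Proof. exact: cpiW. Qed.

Lemma qreprP N M (f : frac N M) : frac_eq (qrepr (qclass f)) f.
Proof. exact: (crepr_pi (frac_eq_equiv N M)). Qed.

Lemma frac_eq_refl N M (f : frac N M) : frac_eq f f.
Proof. by case: (frac_eq_equiv N M) => + _ _; apply. Qed.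
Hint Resolve frac_eq_refl : core.

Section QuotientHom.
Variables N M : lmodType S^c.
Implicit Types p q : Q N M.

Definition qadd p q : Q N M := qclass (frac_add (qrepr p) (qrepr q)).
Definition qscale c p : Q N M := qclass (frac_scale c (qrepr p)).
Definition qzero : Q N M := qclass (frac_hom (mh_zero N M)).
Definition qopp p : Q N M := qscale (-1) p.

Lemma qaddE f g : qadd (qclass f) (qclass g) = qclass (frac_add f g).
Proof. by apply/qclassP/frac_add_eq; apply: qreprP. Qed.
Lemma qscaleE c f : qscale c (qclass f) = qclass (frac_scale c f).
Proof. by apply/qclassP/frac_scale_eq/qreprP. Qed.

Fact qaddA : associative qadd.
Proof.
elim/qclassW=> f; elim/qclassW=> g; elim/qclassW=> h; rewrite !qaddE.
apply/qclassP/frac_eqI => n m fm; exists m; split=> //.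
case: fm => [a [_ [fa [b [c [gb hc ->]]] ->]]].
by exists (a + b), c; rewrite addrA; split=> //; exists a, b.
Qed.
Fact qaddC : commutative qadd.
Proof.
elim/qclassW=> f; elim/qclassW=> g; rewrite !qaddE.
apply/qclassP/frac_eqI => n m fm; exists m; split=> //.
by case: fm => [a [b [fa gb ->]]]; exists b, a; rewrite addrC.
Qed.
Fact qadd0 : left_id qzero qadd.
Proof.
elim/qclassW=> f; rewrite qaddE.
apply/qclassP/frac_eqI => n m fm; exists m; split=> //.
by case: fm => [a [b [/= -> fb ->]]]; rewrite add0r.
Qed.
Fact qaddN : left_inverse qzero qopp qadd.
Proof.
elim/qclassW=> f; rewrite /qopp qscaleE qaddE.
apply/qclassP/frac_eqI => n m [a [b [[b' [fb _]] fb2 _]]].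
exists 0; split=> //; exists (- b), b; rewrite addNr; split=> //.
by exists b; rewrite scaleN1r /ract scaleN1r.
Qed.

HB.instance Definition _ :=
  GRing.isZmodule.Build (Q N M) qaddA qaddC qadd0 qaddN.

Fact qscaleA a b p : qscale a (qscale b p) = qscale (a * b) p.
Proof.
elim/qclassW: p => f; rewrite !qscaleE.
apply/qclassP/frac_eqI => n m fm; exists m; split=> //.
case: fm => [_ [[m' [fm' ->]] ->]]; exists m'; split=> //.
by rewrite mulrC ract_algM.
Qed.
Fact qscale1 : left_id 1 qscale.
Proof.
elim/qclassW=> f; rewrite !qscaleE.
apply/qclassP/frac_eqI => n m fm; exists m; split=> //.
by case: fm => [m' [fm' ->]]; rewrite scale1r ract1.
Qed.
Fact qscaleDr : right_distributive qscale +%R.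
Proof.
move=> c; elim/qclassW=> f; elim/qclassW=> g.
rewrite /GRing.add /= !(qscaleE, qaddE).
apply/qclassP/frac_eqI => n m fm; exists m; split=> //.
case: fm => [_ [[a [b [fa gb ->]]] ->]].
by exists (a *> c%:A), (b *> c%:A); rewrite ractDl; split=> //; [exists a|exists b].
Qed.
Fact qscaleDl p : {morph qscale^~ p : a b / a + b}.
Proof.
move=> a b; elim/qclassW: p => f; rewrite /GRing.add /= !(qscaleE, qaddE).
apply/qclassP/frac_eqI => n m fm; exists m; split=> //.
case: fm => [m' [fm' ->]]; exists (m' *> a%:A), (m' *> b%:A).
by rewrite -ractD -scalerDl; split=> //; exists m'.
Qed.

HB.instance Definition _ := GRing.Zmodule_isLmodule.Build k (Q N M)
  qscaleA qscale1 qscaleDr qscaleDl.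

Lemma qclass_add f g : qclass f + qclass g = qclass (frac_add f g).
Proof. exact: qaddE. Qed.
Lemma qclass_scale c f : c *: qclass f = qclass (frac_scale c f).
Proof. exact: qscaleE. Qed.

End QuotientHom.

Definition qid M : Q M M := qclass (frac_hom (mh_id M)).
Definition qcomp N M L (q : Q M L) (p : Q N M) : Q N L :=
  qclass (frac_comp (qrepr q) (qrepr p)).

Lemma qcompE N M L (g : frac M L) (f : frac N M) :
  qcomp (qclass g) (qclass f) = qclass (frac_comp g f).
Proof. by apply/qclassP/frac_comp_eq; apply: qreprP. Qed.

Fact qcompA N M L T (h : Q L T) (g : Q M L) (f : Q N M) :
  qcomp h (qcomp g f) = qcomp (qcomp h g) f.
Proof.
elim/qclassW: h => h; elim/qclassW: g => g; elim/qclassW: f => f.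
rewrite !qcompE; apply/qclassP/frac_eqI => n m fm; exists m; split=> //.
case: fm => [l [[j [fj gl]] hm]].
by exists j; split=> //; exists l.
Qed.
Fact qcomp1l N M (f : Q N M) : qcomp (qid M) f = f.
Proof.
elim/qclassW: f => f; rewrite qcompE.
apply/qclassP/frac_eqI => n m fm; exists m; split=> //.
by case: fm => [j [fj /= ->]].
Qed.
Fact qcomp1r N M (f : Q N M) : qcomp f (qid N) = f.
Proof.
elim/qclassW: f => f; rewrite qcompE.
apply/qclassP/frac_eqI => n m fm; exists m; split=> //.
by case: fm => [j [/= -> fj]].
Qed.
Fact qcompPl N M L (c : k) (g g' : Q M L) (f : Q N M) :
  qcomp (c *: g + g') f = c *: qcomp g f + qcomp g' f.
Proof.
elim/qclassW: g => g; elim/qclassW: g' => g'; elim/qclassW: f => f.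
rewrite qclass_scale qclass_add !qcompE qclass_scale qclass_add.
apply/qclassP/frac_eqI => n m fm; exists m; split=> //.
case: fm => [j [fj [_ [b [[a [ga ->]] gb ->]]]]].
exists (a *> c%:A), b; split=> //; last by exists j.
by exists a; split=> //; exists j.
Qed.
Fact qcompPr N M L (c : k) (g : Q M L) (f f' : Q N M) :
  qcomp g (c *: f + f') = c *: qcomp g f + qcomp g f'.
Proof.
elim/qclassW: g => g; elim/qclassW: f' => f'; elim/qclassW: f => f.
rewrite qclass_scale qclass_add !qcompE qclass_scale qclass_add.
apply/esym/qclassP/frac_eqI => n m fm; exists m; split=> //.
case: fm => [_ [b [[a [[j [fj gj]] ->]] [i [fi gi]] ->]]].
exists (j *> c%:A + i); split; last by apply: fr_D => //; apply: fr_Z.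
by exists (j *> c%:A), i; split=> //; exists j.
Qed.

Definition QMod : lincat k :=
  @LinCat k (lmodType S^c) Q qid qcomp qcompA qcomp1l qcomp1r qcompPl qcompPr.

Definition qmap N M (f : modhom N M) : Q N M := qclass (frac_hom f).

Fact qmap1 M : qmap (mh_id M) = qid M. Proof. by []. Qed.
Fact qmapM N M L (g : modhom M L) (f : modhom N M) :
  qmap (mh_comp g f) = qcomp (qmap g) (qmap f).
Proof.
rewrite qcompE; apply/qclassP/frac_eqI => n m fm; exists m; split=> //.
by exists (f n).
Qed.
Fact qmapP N M (c : k) (f g : modhom N M) : qmap (c *: f + g) = c *: qmap f + qmap g.
Proof.
rewrite qclass_scale qclass_add.
apply/qclassP/frac_eqI => n m fm; exists m; split=> //.
by exists (f n *> c%:A), (g n); split=> //; exists (f n).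
Qed.

(* the quotient functor, which is the identity on objects *)
Definition qfunctor : linfunctor (Mod S) QMod :=
  @LinFunctor k (Mod S) QMod (fun M => M) qmap qmap1 qmapM qmapP.

End SerreQuotient.

Record modalg_action (k : fieldType) (gT : finGroupType) (R : algType k) :=
  ModalgAction {
    ga_fun :> gT -> {lrmorphism R -> R};
    ga_1 : forall r, ga_fun 1%g r = r;
    ga_M : forall g h r, ga_fun (g * h)%g r = ga_fun g (ga_fun h r) }.

Section Skew.
Variables (k : fieldType) (gT : finGroupType) (R : algType k).
Variable act : modalg_action gT R.

Lemma ga_K g : cancel (act g) (act g^-1%g).
Proof. by move=> r; rewrite -ga_M mulVg ga_1. Qed.
Lemma ga_VK g : cancel (act g^-1%g) (act g).
Proof. by move=> r; rewrite -ga_M mulgV ga_1. Qed.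

(* x : skew stands for \sum_g x g \ox g in R \ox kG *)
Definition skewalg (_ : modalg_action gT R) : Type := {ffun gT -> R}.
Local Notation skew := (skewalg act).
HB.instance Definition _ := GRing.Lmodule.copy skew {ffun gT -> R}.
Implicit Types x y z : skew.

(* coefficient of h in the sum of the (x g \ox g) (y g' \ox g') *)
Definition skew_mul x y : skew :=
  [ffun h => \sum_(g : gT) x g * act g (y (g^-1 * h)%g)].

Definition skew_embed (r : R) : skew := [ffun h => if h == 1%g then r else 0].

Definition skew_elt (g : gT) : skew := [ffun h => if h == g then 1 else 0].

Lemma skew_mulE x y h :
  skew_mul x y h = \sum_(g : gT) x g * act g (y (g^-1 * h)%g).
Proof. by rewrite ffunE. Qed.

Lemma skew0 h : (0 : skew) h = 0. Proof. by rewrite ffunE. Qed.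
Lemma skewD x y h : (x + y) h = x h + y h. Proof. by rewrite ffunE. Qed.
Lemma skewN x h : (- x) h = - x h. Proof. by rewrite ffunE. Qed.
Lemma skewZ (c : k) x h : (c *: x) h = c *: x h. Proof. by rewrite ffunE. Qed.

Fact skew_mulA : associative skew_mul.
Proof.
move=> x y z; apply/ffunP => h; rewrite !skew_mulE.
under [RHS]eq_bigr => g _ do rewrite skew_mulE mulr_suml.
rewrite exchange_big; apply: eq_bigr => f _ /=.
rewrite skew_mulE linear_sum mulr_sumr (reindex_inj (mulgI f^-1%g)) /=.
apply: eq_bigr => g _; rewrite rmorphM /= -ga_M mulrA mulVKg.
by rewrite invMg invgK -mulgA mulKVg.
Qed.

Fact skew_mul1l : left_id (skew_elt 1) skew_mul.
Proof.
move=> x; apply/ffunP => h; rewrite skew_mulE (bigD1 1%g) //= ffunE eqxx mul1r.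
rewrite ga_1 invg1 mul1g big1 ?addr0 // => g /negPf ng.
by rewrite ffunE ng mul0r.
Qed.

Fact skew_mul1r : right_id (skew_elt 1) skew_mul.
Proof.
move=> x; apply/ffunP => h; rewrite skew_mulE (bigD1 h) //= ffunE mulVg eqxx.
rewrite rmorph1 mulr1 big1 ?addr0 // => g ng.
by rewrite ffunE -eq_mulVg1 (negPf ng) rmorph0 mulr0.
Qed.

Fact skew_mulDl : left_distributive skew_mul +%R.
Proof.
move=> x y z; apply/ffunP => h; rewrite !(ffunE, skew_mulE) -big_split /=.
by apply: eq_bigr => g _; rewrite ffunE mulrDl.
Qed.

Fact skew_mulDr : right_distributive skew_mul +%R.
Proof.
move=> x y z; apply/ffunP => h; rewrite !(ffunE, skew_mulE) -big_split /=.
by apply: eq_bigr => g _; rewrite ffunE rmorphD mulrDr.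
Qed.

Fact skew_1neq0 : skew_elt 1 != 0.
Proof.
apply/eqP => /ffunP /(_ 1%g) /eqP; rewrite !ffunE eqxx.
by rewrite (negPf (oner_neq0 R)).
Qed.

HB.instance Definition _ := GRing.Zmodule_isNzRing.Build skew
  skew_mulA skew_mul1l skew_mul1r skew_mulDl skew_mulDr skew_1neq0.

Fact skew_scaleAl (c : k) x y : c *: (x * y) = (c *: x) * y.
Proof.
apply/ffunP => h; rewrite ffunE /GRing.mul /= !skew_mulE scaler_sumr.
by apply: eq_bigr => g _; rewrite ffunE scalerAl.
Qed.
HB.instance Definition _ := GRing.Lmodule_isLalgebra.Build k skew skew_scaleAl.

Fact skew_scaleAr (c : k) x y : c *: (x * y) = x * (c *: y).
Proof.
apply/ffunP => h; rewrite ffunE /GRing.mul /= !skew_mulE scaler_sumr.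
by apply: eq_bigr => g _; rewrite ffunE linearZ /= scalerAr.
Qed.
HB.instance Definition _ := GRing.Lalgebra_isAlgebra.Build k skew skew_scaleAr.

Lemma skewM x y h : (x * y) h = \sum_(g : gT) x g * act g (y (g^-1 * h)%g).
Proof. exact: skew_mulE. Qed.

Lemma skew_sum n (x : 'I_n -> skew) h :
  (\sum_(i < n) x i) h = \sum_(i < n) x i h.
Proof. by elim/big_rec2: _ => [|i y1 y2 _ <-]; rewrite ?skew0 ?skewD. Qed.

Lemma skew_embedMl r x h : (skew_embed r * x) h = r * x h.
Proof.
rewrite skewM (bigD1 1%g) //= ffunE eqxx ga_1 invg1 mul1g big1 ?addr0 //.
by move=> g /negPf ng; rewrite ffunE ng mul0r.
Qed.

Lemma skew_embedMr r x h : (x * skew_embed r) h = x h * act h r.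
Proof.
rewrite skewM (bigD1 h) //= ffunE mulVg eqxx big1 ?addr0 // => g ng.
by rewrite ffunE -eq_mulVg1 (negPf ng) rmorph0 mulr0.
Qed.

Lemma skew_eltMl g x h : (skew_elt g * x) h = act g (x (g^-1 * h)%g).
Proof.
rewrite skewM (bigD1 g) //= ffunE eqxx mul1r big1 ?addr0 // => f /negPf nf.
by rewrite ffunE nf mul0r.
Qed.

Lemma skew_embed_linear : linear skew_embed.
Proof.
move=> c x y; apply/ffunP => h; rewrite !ffunE; case: ifP => // _.
by rewrite scaler0 addr0.
Qed.

Lemma skew_embed1 : skew_embed 1 = 1.
Proof. by []. Qed.

Lemma skew_embedM a b : skew_embed (a * b) = skew_embed a * skew_embed b.
Proof.
apply/ffunP => h; rewrite skew_embedMl !ffunE.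
by case: ifP => // _; rewrite mulr0.
Qed.

Lemma skew_elt1 : skew_elt 1 = 1. Proof. by []. Qed.

Lemma skew_eltM g h : skew_elt (g * h) = skew_elt g * skew_elt h.
Proof.
apply/ffunP => f; rewrite skew_eltMl !ffunE.
rewrite (can2_eq (mulKVg g) (mulKg g)).
by case: ifP; rewrite (rmorph0, rmorph1).
Qed.

Lemma skew_eltC g r : skew_elt g * skew_embed r = skew_embed (act g r) * skew_elt g.
Proof.
apply/ffunP => h; rewrite skew_embedMr skew_embedMl !ffunE.
by case: eqP => [->|]; rewrite ?mul1r ?mulr1 ?mul0r ?mulr0.
Qed.

Definition pertinent n (a b : 'I_n -> R) :=
  forall g : gT, g != 1%g -> \sum_(i < n) a i * act g (b i) = 0.

(* families indexed by 'I_n.+1: sequences of length at least 1 *)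
Definition Gradical_pred (r : R) : Prop :=
  exists n (a b : 'I_n.+1 -> R), pertinent a b /\ r = \sum_(i < n.+1) a i * b i.

Fact Gradical_0 : Gradical_pred 0.
Proof.
exists 0%N, (fun=> 0), (fun=> 0); split; last by rewrite big_ord1 mul0r.
by move=> g _; rewrite big_ord1 mul0r.
Qed.

Lemma sum_ord_catM m n (a b : 'I_m -> R) (c d : 'I_n -> R) :
  \sum_(i < m + n)
    (match split i with inl j => a j | inr j => c j end) *
    (match split i with inl j => b j | inr j => d j end) =
  \sum_(i < m) a i * b i + \sum_(i < n) c i * d i.
Proof.
rewrite big_split_ord /=; congr (_ + _); apply: eq_bigr => i _.
  by case: split_ordP => j /eqP; rewrite (eq_lshift, eq_lrshift) // => /eqP ->.
case: split_ordP => j /eqP; rewrite ?eq_rlshift ?eq_rshift //.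
by move=> /eqP ->.
Qed.

Fact Gradical_D (x y : R) : Gradical_pred x -> Gradical_pred y -> Gradical_pred (x + y).
Proof.
move=> [m [a [b [pab ->]]]] [n [c [d [pcd ->]]]].
exists (m + n.+1)%N.
exists (fun i : 'I_(m.+1 + n.+1) => match split i with inl j => a j | inr j => c j end).
exists (fun i : 'I_(m.+1 + n.+1) => match split i with inl j => b j | inr j => d j end).
split; last by rewrite (sum_ord_catM a b c d).
move=> g ng; have := sum_ord_catM a (fun j => act g (b j)) c (fun j => act g (d j)).
rewrite pab // pcd // addr0 => e; apply: etrans e.
by apply: eq_bigr => i _; case: (@split m.+1 n.+1 i).
Qed.

Fact Gradical_Ml (a x : R) : Gradical_pred x -> Gradical_pred (a * x).
Proof.
move=> [n [c [d [pcd ->]]]]; exists n, (fun i => a * c i), d; split=> [g ng|].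
  by under eq_bigr do rewrite -mulrA; rewrite -mulr_sumr pcd ?mulr0.
by rewrite mulr_sumr; apply: eq_bigr => i _; rewrite mulrA.
Qed.

Fact Gradical_Mr (x a : R) : Gradical_pred x -> Gradical_pred (x * a).
Proof.
move=> [n [c [d [pcd ->]]]]; exists n, c, (fun i => d i * a); split=> [g ng|].
  by under eq_bigr do rewrite rmorphM mulrA; rewrite -mulr_suml pcd ?mul0r.
by rewrite mulr_suml; apply: eq_bigr => i _; rewrite mulrA.
Qed.

Definition Gradical : ideal R :=
  Ideal (And3 Gradical_0 Gradical_D Gradical_Ml)
        (And3 Gradical_0 Gradical_D Gradical_Mr).

Lemma Gradical_stable g (x : R) : Gradical x -> Gradical (act g x).
Proof.
move=> [n [c [d [pcd ->]]]].
exists n, (fun i => act g (c i)), (fun i => act g (d i)); split=> [h nh|].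
  have := pcd (h ^ g)%g; rewrite conjg_eq1 nh => /(_ isT).
  move=> /(congr1 (act g)); rewrite rmorph0 rmorph_sum /= => e.
  apply: etrans e; apply: eq_bigr => i _; rewrite rmorphM /=; congr (_ * _).
  by rewrite -!ga_M -conjgC.
by rewrite rmorph_sum; apply: eq_bigr => i _; rewrite rmorphM.
Qed.

Lemma Gradical_pow_stable g n (x : R) :
  ideal_pow Gradical n x -> ideal_pow Gradical n (act g x).
Proof.
elim: n x => //= n IH _ [m [a [b [ha hb ->]]]].
exists m, (fun i => act g (a i)), (fun i => act g (b i)); split=> [i|i|].
- exact: IH.
- exact: (Gradical_stable g (hb i)).
by rewrite rmorph_sum; apply: eq_bigr => i _; rewrite rmorphM.
Qed.

Lemma Gradical_sum (I : finType) (x : I -> R) :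
  (forall i, Gradical (x i)) -> Gradical (\sum_i x i).
Proof.
move=> rx; apply: big_ind => [|u v|i _]; [exact: Gradical_0|exact: Gradical_D|].
exact: rx.
Qed.

(* r \ox kG, for r the G-radical: all coefficients lie in r *)
Definition skew_rad_pred x : Prop := forall g, Gradical (x g).

Fact skew_rad_0 : skew_rad_pred 0.
Proof. by move=> g; rewrite ffunE; apply: Gradical_0. Qed.
Fact skew_rad_D x y : skew_rad_pred x -> skew_rad_pred y -> skew_rad_pred (x + y).
Proof. by move=> hx hy g; rewrite skewD; exact: (Gradical_D (hx g) (hy g)). Qed.
Fact skew_rad_Ml a x : skew_rad_pred x -> skew_rad_pred (a * x).
Proof.
move=> hx h; rewrite skewM; apply: Gradical_sum => g.
exact: (Gradical_Ml (a g) (Gradical_stable g (hx _))).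
Qed.
Fact skew_rad_Mr x a : skew_rad_pred x -> skew_rad_pred (x * a).
Proof.
move=> hx h; rewrite skewM; apply: Gradical_sum => g.
exact: (Gradical_Mr _ (hx g)).
Qed.

Definition skew_radical : ideal skew :=
  Ideal (And3 skew_rad_0 skew_rad_D skew_rad_Ml)
        (And3 skew_rad_0 skew_rad_D skew_rad_Mr).

Lemma skew_noetherian_aux (noeR : right_noetherian R) (gs : seq gT)
    (c : skew -> Prop) :
  c 0 -> (forall x y, c x -> c y -> c (x + y)) ->
  (forall x r, c x -> c (x * skew_embed r)) ->
  (forall x, c x -> forall g, g \notin gs -> x g = 0) ->
  exists n (x : 'I_n -> skew), (forall i, c (x i)) /\
    forall y, c y -> exists a : 'I_n -> skew, y = \sum_(i < n) x i * a i.
Proof.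
elim: gs c => [|g gs IH] c c0 cD cM supp.
  exists 0%N, (fun=> 0); split=> [[]//|y cy]; exists (fun=> 0).
  by rewrite big_ord0; apply/ffunP => h; rewrite skew0 (supp y).
have cN x : c x -> c (- x).
  move=> /(cM _ (-1)); congr (c _); apply/ffunP => h.
  by rewrite skew_embedMr rmorphN1 mulrN1 skewN.
pose lead (r : R) := exists2 x, c x & x g = r.
have [|n [r [leadr genr]]] := noeR lead.
  split; first by exists 0; rewrite ?skew0.
    by move=> _ _ [x cx <-] [y cy <-]; exists (x + y); rewrite ?skewD //; apply: cD.
  move=> _ a [x cx <-]; exists (x * skew_embed (act g^-1%g a)); first exact: cM.
  by rewrite skew_embedMr ga_VK.
have /choice [x hx] : forall i, exists x, c x /\ x g = r i.
  by move=> i; have [x cx xg] := leadr i; exists x.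
pose c' y := c y /\ y g = 0.
have [|u v [cu ug] [cv vg]|u a [cu ug]|u [cu ug] h|m [z [c'z genz]]] := IH c'.
- by split; rewrite ?skew0.
- by split; [apply: cD|rewrite skewD ug vg addr0].
- by split; [apply: cM|rewrite skew_embedMr ug mul0r].
- have [->|ng] := eqVneq h g; first by [].
  by move=> hgs; apply: supp => //; rewrite inE negb_or ng.
exists (n + m)%N.
exists (fun i => match split i with inl j => x j | inr j => z j end).
split=> [i|y cy].
  by case: (split i) => j; [case: (hx j)|case: (c'z j)].
have [a ea] : exists a : 'I_n -> R, y g = \sum_(i < n) r i * a i.
  by apply: genr; exists y.
pose b i := skew_embed (act g^-1%g (a i)).
have cs : c (\sum_(i < n) x i * b i).
  by elim/big_ind: _ => // i _; apply: cM; case: (hx i).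
have [d ed] : exists d : 'I_m -> skew,
    y - \sum_(i < n) x i * b i = \sum_(i < m) z i * d i.
  apply: genz; split; first by apply: cD => //; apply: cN.
  rewrite skewD skewN skew_sum ea -sumrB big1 // => i _.
  by rewrite skew_embedMr ga_VK; case: (hx i) => _ ->; rewrite subrr.
exists (fun i => match split i with inl j => b j | inr j => d j end).
rewrite -(subrK (\sum_(i < n) x i * b i) y) ed addrC big_split_ord /=.
congr (_ + _); apply: eq_bigr => i _.
  by case: split_ordP => j /eqP; rewrite (eq_lshift, eq_lrshift) // => /eqP ->.
case: split_ordP => j /eqP; rewrite ?eq_rlshift ?eq_rshift //.
by move=> /eqP ->.
Qed.

Lemma skew_right_noetherian : right_noetherian R -> right_noetherian skew.
Proof.
move=> noeR c [c0 cD cM].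
apply: (skew_noetherian_aux noeR (gs := enum gT)) => // [x r|x _ g]; first exact: cM.
by rewrite mem_enum inE.
Qed.

End Skew.

Section EquivariantHom.
Variables (k : fieldType) (gT : finGroupType) (R : algType k).
Variable act : modalg_action gT R.
Local Notation B := (skewalg act).
Implicit Types N M : lmodType B^c.

(* restriction of right B-modules along R -> B, r |-> r \ox 1 *)
Definition restr M : Type := M.
HB.instance Definition _ M := GRing.Zmodule.on (restr M).

Definition restr_scale M (r : R^c) (m : restr M) : restr M :=
  (m : M) *> skew_embed act r.

Fact restr_scaleA M (a b : R^c) (m : restr M) :
  restr_scale a (restr_scale b m) = restr_scale (a * b) m.
Proof. by rewrite /restr_scale -ractM -skew_embedM. Qed.
Fact restr_scale1 M : left_id 1 (@restr_scale M).
Proof. by move=> m; rewrite /restr_scale; apply: ract1. Qed.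
Fact restr_scaleDr M : right_distributive (@restr_scale M) +%R.
Proof. by move=> a m n; apply: ractDl. Qed.
Fact restr_scaleDl M (m : restr M) : {morph (@restr_scale M)^~ m : a b / a + b}.
Proof.
move=> a b; rewrite /restr_scale -ractD; congr (_ *> _).
by have := skew_embed_linear act 1 a b; rewrite !scale1r.
Qed.
HB.instance Definition _ M := GRing.Zmodule_isLmodule.Build R^c (restr M)
  (@restr_scaleA M) (@restr_scale1 M) (@restr_scaleDr M) (@restr_scaleDl M).

Lemma restr_ract M (m : restr M) (r : R) : m *> r = (m : M) *> skew_embed act r.
Proof. by []. Qed.

Lemma skew_embed_alg (c : k) : skew_embed act c%:A = c%:A.
Proof.
have := skew_embed_linear act c 1 0; rewrite !addr0 => ->.
have -> : skew_embed act 0 = 0.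
  by apply/ffunP => h; rewrite skew0 ffunE if_same.
by rewrite addr0.
Qed.

Lemma restr_algC M (m : restr M) (c : k) : m *> (c%:A : R) = (m : M) *> c%:A.
Proof. by rewrite restr_ract skew_embed_alg. Qed.

Fact restr_hom_linear N M (f : modhom N M) :
  linear (fun n : restr N => f n : restr M).
Proof.
move=> a x y; apply: etrans (linearD f ((x : N) *> skew_embed act a) y) _.
congr (_ + _); exact: (mh_ract f (x : N) (skew_embed act a)).
Qed.
Definition restr_hom N M (f : modhom N M) : modhom (restr N) (restr M) :=
  ModHom (restr_hom_linear f).

Fact restr_hom1 M : restr_hom (mh_id M) = mh_id (restr M).
Proof. exact: modhomP. Qed.
Fact restr_homM N M L (g : modhom M L) (f : modhom N M) :
  restr_hom (mh_comp g f) = mh_comp (restr_hom g) (restr_hom f).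
Proof. exact: modhomP. Qed.
Fact restr_homP N M (c : k) (f g : modhom N M) :
  restr_hom (c *: f + g) = c *: restr_hom f + restr_hom g.
Proof. by apply: modhomP => n /=; congr (_ + _); rewrite restr_algC. Qed.

Definition restriction : linfunctor (Mod B) (Mod R) :=
  @LinFunctor k (Mod B) (Mod R) (fun M => restr M) restr_hom
    restr_hom1 restr_homM restr_homP.

Hypothesis noeR : right_noetherian R.
Local Notation r := (Gradical act).
Local Notation QR := (QMod r noeR).

Definition res_quotient : linfunctor (Mod B) QR :=
  fcomp (qfunctor r noeR) restriction.

Definition gract M (m : M) (g : gT) : M := m *> skew_elt act g.

Lemma gract1 M (m : M) : gract m 1%g = m.
Proof. exact: ract1. Qed.
Lemma gractM M (m : M) g h : gract m (g * h)%g = gract (gract m g) h.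
Proof. by rewrite /gract skew_eltM ractM. Qed.
Lemma gractK M g : cancel ((@gract M)^~ g) ((@gract M)^~ g^-1%g).
Proof. by move=> m; rewrite -gractM mulgV gract1. Qed.
Lemma gractVK M g : cancel ((@gract M)^~ g^-1%g) ((@gract M)^~ g).
Proof. by move=> m; rewrite -gractM mulVg gract1. Qed.
Lemma gractD M (m n : M) g : gract (m + n) g = gract m g + gract n g.
Proof. exact: ractDl. Qed.
Lemma gract0 M g : gract (0 : M) g = 0.
Proof. exact: ract0l. Qed.
Lemma gract_restr M (m : restr M) a g :
  (gract (m : M) g : restr M) *> a = gract ((m : restr M) *> act g a : M) g.
Proof. by rewrite !restr_ract /gract -!ractM skew_eltC. Qed.
Lemma gract_restrV M (m : restr M) a g :
  gract (m *> a : M) g = (gract (m : M) g : restr M) *> act g^-1%g a.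
Proof. by rewrite gract_restr ga_VK. Qed.

(* The right action of G on Hom_R(N', M / M') is (f <- g)(n) = f (n g^-1) g:
   on graphs, (n, m) belongs to f <- g iff (n g^-1, m g^-1) belongs to f. *)
Section FracAct.
Variables (N M : lmodType B^c) (g : gT) (f : frac r (restr N) (restr M)).

Definition frac_act_rel (n : restr N) (m : restr M) : Prop :=
  f (gract (n : N) g^-1%g) (gract (m : M) g^-1%g).
Fact frac_act_0 : frac_act_rel 0 0.
Proof. by rewrite /frac_act_rel !gract0; apply: fr_0. Qed.
Fact frac_act_D n m n' m' : frac_act_rel n m -> frac_act_rel n' m' ->
  frac_act_rel (n + n') (m + m').
Proof. by rewrite /frac_act_rel !gractD; apply: fr_D. Qed.
Fact frac_act_Z n m a : frac_act_rel n m -> frac_act_rel (n *> a) (m *> a).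
Proof. by rewrite /frac_act_rel !gract_restrV; apply: fr_Z. Qed.
Fact frac_act_dom :
  mod_torsion r (fun=> True) (fun n => exists m, frac_act_rel n m).
Proof.
move=> n _; have [p hp] := fr_dom f (m := gract (n : N) g^-1%g) I.
exists p => x rx; have [m fm] := hp _ (Gradical_pow_stable g rx).
exists (gract (m : M) g); rewrite /frac_act_rel gractK gract_restrV invgK.
exact: fm.
Qed.
Fact frac_act_fib : mod_torsion r (frac_act_rel 0) (fun m => m = 0).
Proof.
move=> m; rewrite /frac_act_rel gract0 => /fr_fib [p hp].
exists p => x rx; have := hp _ (Gradical_pow_stable g rx).
rewrite gract_restr ga_K => /(congr1 (fun m : M => gract m g)).
by rewrite gractVK gract0.
Qed.
Definition frac_act : frac r (restr N) (restr M) :=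
  Frac frac_act_0 frac_act_D frac_act_Z frac_act_dom frac_act_fib.

End FracAct.

Lemma frac_act_eq N M g (f f' : frac r (restr N) (restr M)) :
  frac_eq f f' -> frac_eq (frac_act g f) (frac_act g f').
Proof.
move=> e n _; have [p hp] := e (gract (n : N) g^-1%g) I.
exists p => x rx; have [m [fm fm']] := hp _ (Gradical_pow_stable g rx).
exists (gract (m : M) g); rewrite /= /frac_act_rel gractK gract_restrV invgK.
by [].
Qed.

Local Notation F := res_quotient.
Local Notation Q N M := (mor (F N) (F M)).

Definition qact N M (g : gT) (q : Q N M) : Q N M := qclass noeR (frac_act g (qrepr q)).

Lemma qactE N M g (f : frac r (restr N) (restr M)) :
  qact g (qclass noeR f) = qclass noeR (frac_act g f).
Proof. by apply/qclassP/frac_act_eq/qreprP. Qed.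

Lemma qact1 N M (q : Q N M) : qact 1%g q = q.
Proof.
elim/qclassW: q => f; rewrite qactE.
apply/qclassP/frac_eqI => n m fm; exists m; split=> //.
by move: fm; rewrite /= /frac_act_rel invg1 !gract1.
Qed.

Lemma qactM N M g h (q : Q N M) : qact (g * h)%g q = qact h (qact g q).
Proof.
elim/qclassW: q => f; rewrite (qactE (g * h)) (qactE g) (qactE h).
apply/qclassP/frac_eqI => n m fm; exists m; split=> //.
by have := fm; rewrite /= {1}/frac_act_rel invMg !gractM.
Qed.

Fact qact_linear N M g : linear (@qact N M g).
Proof.
move=> c; elim/qclassW=> f; elim/qclassW=> f'.
rewrite qclass_scale qclass_add (qactE g f) (qactE g f') (qactE g) qclass_scale qclass_add.
apply/qclassP/frac_eqI => n m fm; exists m; split=> //.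
case: fm => [_ [b [[a [fa ->]] fb e]]].
exists ((gract (a : M) g : restr M) *> c%:A), (gract (b : M) g).
split.
- by exists (gract (a : M) g); rewrite /= /frac_act_rel gractK.
- by rewrite /= /frac_act_rel gractK.
apply: (can_inj (@gractVK M g)).
rewrite /= e gractD gract_restrV !gractK; congr (_ *> _ + _).
by rewrite linearZ /= rmorph1.
Qed.

HB.instance Definition _ N M g :=
  GRing.isLinear.Build k (Q N M) (Q N M) _ (@qact N M g) (@qact_linear N M g).

Lemma qact_natural N M L g (h : modhom M L) (q : Q N M) :
  qact g (fmap F h \oc q) = fmap F h \oc qact g q.
Proof.
elim/qclassW: q => f; rewrite (qactE g f).
apply: etrans (congr1 (qact g) (qcompE _ _ _)) _; rewrite qactE.
apply: etrans (esym (qcompE _ _ _)).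
apply/qclassP/frac_eqI => n m fm; exists m; split=> //.
case: fm => [j [fj e]]; exists (gract (j : M) g); split.
  by rewrite /= /frac_act_rel gractK.
apply: (can_inj (@gractVK L g)); apply: etrans e _.
apply: etrans (mh_ract h (gract (j : M) g) (skew_elt act g^-1%g)).
by apply: (congr1 h); rewrite -/(gract _ _) gractK.
Qed.

(* The action on the class of an R-linear map N r^p -> M, see [qact_pow_map];
   such a map is given by a function on N, used only on N r^p. *)
Section PowerMaps.
Variables (N M : lmodType B^c) (p : nat).

Definition mod_pow (L : lmodType R^c) (n : L) : Prop :=
  exists q (x : 'I_q -> L) (a : 'I_q -> R),
    (forall i, ideal_pow r p (a i)) /\ n = \sum_(i < q) x i *> a i.

Record pow_map := PowMap {
  pm_fun :> restr N -> restr M;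
  pm_D : forall x y, mod_pow x -> mod_pow y -> pm_fun (x + y) = pm_fun x + pm_fun y;
  pm_Z : forall x a, mod_pow x -> pm_fun (x *> a) = pm_fun x *> a }.

Lemma mod_pow_0 (L : lmodType R^c) : mod_pow (0 : L).
Proof.
exists 0%N, (fun=> 0), (fun=> 0); split; first by case.
by rewrite big_ord0.
Qed.

Lemma mod_pow_D (L : lmodType R^c) (x y : L) : mod_pow x -> mod_pow y -> mod_pow (x + y).
Proof.
move=> [q [u [a [ha ->]]]] [q' [v [b [hb ->]]]]; exists (q + q')%N.
exists (fun i => match split i with inl j => u j | inr j => v j end).
exists (fun i => match split i with inl j => a j | inr j => b j end).
split; first by move=> i; case: (split i).
rewrite big_split_ord /=; congr (_ + _); apply: eq_bigr => i _.
  by case: split_ordP => j /eqP; rewrite (eq_lshift, eq_lrshift) // => /eqP ->.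
case: split_ordP => j /eqP; rewrite ?eq_rlshift ?eq_rshift //.
by move=> /eqP ->.
Qed.

Lemma mod_pow_Z (L : lmodType R^c) (x : L) a : mod_pow x -> mod_pow (x *> a).
Proof.
move=> [q [u [b [hb ->]]]]; exists q, u, (fun i => b i * a); split=> [i|].
  exact: ideal_pow_mulr.
rewrite /ract scaler_sumr; apply: eq_bigr => i _.
exact: esym (ractM _ _ _).
Qed.

Lemma mod_pow_act (x : restr N) g : mod_pow x -> mod_pow (gract (x : N) g : restr N).
Proof.
move=> [q [u [b [hb ->]]]].
exists q, (fun i => gract (u i : N) g : restr N), (fun i => act g^-1%g (b i)).
split=> [i|]; first exact: Gradical_pow_stable.
rewrite (big_morph (fun x : restr N => gract (x : N) g : restr N)
  (fun x y => @gractD N x y g) (@gract0 N g)).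
by apply: eq_bigr => i _; apply: gract_restrV.
Qed.

Lemma pm_0 (f : pow_map) : f 0 = 0.
Proof.
have := pm_Z f 0 (mod_pow_0 (restr N)); rewrite ract0l => ->; exact: ract0.
Qed.

Section Graph.
Variable f : pow_map.
Definition pow_graph_rel n m := mod_pow n /\ m = f n.
Fact pow_graph_0 : pow_graph_rel 0 0.
Proof. by split; [apply: mod_pow_0|rewrite pm_0]. Qed.
Fact pow_graph_D n m n' m' : pow_graph_rel n m -> pow_graph_rel n' m' ->
  pow_graph_rel (n + n') (m + m').
Proof.
by move=> [hn ->] [hn' ->]; split; [apply: mod_pow_D|rewrite pm_D].
Qed.
Fact pow_graph_Z n m a : pow_graph_rel n m -> pow_graph_rel (n *> a) (m *> a).
Proof. by move=> [hn ->]; split; [apply: mod_pow_Z|rewrite pm_Z]. Qed.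
Fact pow_graph_dom : mod_torsion r (fun=> True) (fun n => exists m, pow_graph_rel n m).
Proof.
move=> n _; exists p => x rx; exists (f (n *> x)); split=> //.
by exists 1%N, (fun=> n), (fun=> x); rewrite big_ord1.
Qed.
Fact pow_graph_fib : mod_torsion r (pow_graph_rel 0) (fun m => m = 0).
Proof. by move=> m [_ ->]; exists 0%N => x _; rewrite pm_0 ract0l. Qed.
Definition pow_graph : frac r (restr N) (restr M) :=
  Frac pow_graph_0 pow_graph_D pow_graph_Z pow_graph_dom pow_graph_fib.

Variable g : gT.
Definition pow_act_fun (n : restr N) : restr M :=
  gract (f (gract (n : N) g^-1%g) : M) g.
Fact pow_act_D x y : mod_pow x -> mod_pow y ->
  pow_act_fun (x + y) = pow_act_fun x + pow_act_fun y.
Proof.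
move=> hx hy; rewrite /pow_act_fun gractD pm_D; try exact: mod_pow_act.
exact: gractD.
Qed.
Fact pow_act_Z x a : mod_pow x -> pow_act_fun (x *> a) = pow_act_fun x *> a.
Proof.
move=> hx; rewrite /pow_act_fun gract_restrV invgK pm_Z; last exact: mod_pow_act.
by rewrite [RHS]gract_restr.
Qed.
(* (f <- g)(n) = f (n g^-1) g *)
Definition pow_act : pow_map := PowMap pow_act_D pow_act_Z.

End Graph.

Lemma qact_pow_map (f : pow_map) g :
  qact g (qclass noeR (pow_graph f) : Q N M) = qclass noeR (pow_graph (pow_act f g)).
Proof.
rewrite qactE; apply/qclassP/frac_eqI => n m fm; exists m; split=> //.
case: fm => hn e; split; first by rewrite -[n](gractVK g); apply: mod_pow_act hn.
by rewrite /= /pow_act_fun -e gractVK.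
Qed.

End PowerMaps.

Section HomAction.
Variables (N : lmodType B^c) (I : cocomplex (Mod B)).

Fact hom_action_comm g n (q : Q N (I n)) :
  qact g (kd (hom_complex (F N) (fmap_cx F I)) n q) =
  kd (hom_complex (F N) (fmap_cx F I)) n (qact g q).
Proof. exact: qact_natural. Qed.

Definition hom_action g :
    kc_map (hom_complex (F N) (fmap_cx F I)) (hom_complex (F N) (fmap_cx F I)) :=
  @KcMap _ (hom_complex (F N) (fmap_cx F I)) (hom_complex (F N) (fmap_cx F I))
    (fun n => @qact N (I n) g) (hom_action_comm g).

End HomAction.

End EquivariantHom.

Section RightAction.
Variables (k : fieldType) (gT : finGroupType) (V : lmodType k).

Record right_action := RightAction {
  ra_fun :> gT -> {linear V -> V};
  ra_1 : forall v, ra_fun 1%g v = v;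
  ra_M : forall g h v, ra_fun (g * h)%g v = ra_fun h (ra_fun g v) }.

Variable rho : right_action.

Fact invariants_0 g : rho g 0 = 0. Proof. exact: linear0. Qed.
Fact invariants_D x y : (forall g, rho g x = x) -> (forall g, rho g y = y) ->
  forall g, rho g (x + y) = x + y.
Proof. by move=> hx hy g; rewrite linearD hx hy. Qed.
Fact invariants_Z c x : (forall g, rho g x = x) -> forall g, rho g (c *: x) = c *: x.
Proof. by move=> hx g; rewrite linearZ /= hx. Qed.

Definition invariants : submod V :=
  @Submod _ _ (fun v => forall g, rho g v = v) invariants_0 invariants_D invariants_Z.

End RightAction.

Section QuotientFunctors.
Variables (k : fieldType) (gT : finGroupType) (R : algType k).
Variables (act : modalg_action gT R) (noeR : noetherian R).

Definition to_QModR :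
    linfunctor (Mod (skewalg act)) (QMod (Gradical act) (proj2 noeR)) :=
  res_quotient act (proj2 noeR).

Definition to_QModB :
    linfunctor (Mod (skewalg act))
      (QMod (skew_radical act) (skew_right_noetherian (act := act) (proj2 noeR))) :=
  qfunctor (skew_radical act) (skew_right_noetherian (act := act) (proj2 noeR)).

End QuotientFunctors.

(* Main.v *)
(** Write F for the composite of restriction to R with the quotient functor to
    QMod_r R. If E is injective over B, then Baer's criterion holds for E over R,
    because a map defined on a right ideal c of R extends to the right ideal c B.
    By the Artin-Rees property it also holds for E / Gamma(E), and hence F E is
    injective in QMod_r R. So F I is an injective resolution of F M.

    A morphism of QMod_b B is the same as a G-invariant morphism of QMod_r R, as
    the intersection of the G-translates of an invariant fraction is B-stable.
    Since |G| is invertible, averaging shows that the images of the I^n are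
    injective in QMod_b B as well, and that the invariants of the cohomology of
    Hom(F N, F I) are the cohomology of its subcomplex Hom(N, I) of invariants. *)

Require Import Defs.
From HB Require Import structures.
From mathcomp Require Import all_boot all_order all_algebra fingroup.
From mathcomp Require Import boolp classical_sets.

Set Implicit Arguments.
Unset Strict Implicit.
Unset Printing Implicit Defensive.

Import Defs GRing.Theory.
Local Open Scope ring_scope.

(** * Comparison of augmented complexes: chain maps and homotopies *)

Section Comparison.
Variables (k : fieldType) (C : lincat k).
Implicit Types X Y Z E : C.

Lemma mcompDl X Y Z (g g' : mor Y Z) (f : mor X Y) :
  (g + g') \oc f = g \oc f + g' \oc f.
Proof. by have := mcompPl 1 g g' f; rewrite !scale1r. Qed.

Lemma mcompBl X Y Z (g g' : mor Y Z) (f : mor X Y) :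
  (g - g') \oc f = g \oc f - g' \oc f.
Proof. by rewrite -scaleN1r addrC mcompPl addrC scaleN1r. Qed.

Lemma mcompBr X Y Z (g : mor Y Z) (f f' : mor X Y) :
  g \oc (f - f') = g \oc f - g \oc f'.
Proof. exact: (linearB (postcomp g)). Qed.

Lemma mcompZl X Y Z c (g : mor Y Z) (f : mor X Y) :
  (c *: g) \oc f = c *: (g \oc f).
Proof. by have := mcompPl c g 0 f; rewrite mcomp0l !addr0. Qed.

Lemma mono0 X Y (f : mor X Y) : mono f -> forall W (w : mor W X), f \oc w = 0 -> w = 0.
Proof. by move=> fm W w fw; apply: fm; rewrite fw mcomp0r. Qed.

(** The map [w] factors through the kernel [i] of [g], and [u] vanishes on [i] because [f] is [i]
    after the epimorphism [e]. *)
Lemma exact_at_kill X Y Z W E (f : mor X Y) (g : mor Y Z) (w : mor W Y) (u : mor Y E) :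
  exact_at f g -> g \oc w = 0 -> u \oc f = 0 -> u \oc w = 0.
Proof.
move=> [K [i [e [[gi kerP] epie ->]]]] gw ufe.
have [v [<- _]] := kerP _ _ gw.
suff ui : u \oc i = 0 by rewrite mcompA ui mcomp0l.
by apply: epie; rewrite -mcompA ufe mcomp0l.
Qed.

(* Hom(-, E) is exact on the augmented complex Y -> D^0 -> D^1 -> ... *)
Definition lifts_to Y (D : cocomplex C) (aug : mor Y (D 0%N)) E : Prop :=
  [/\ forall u : mor Y E, exists v : mor (D 0%N) E, v \oc aug = u,
      forall u : mor (D 0%N) E, u \oc aug = 0 ->
        exists v : mor (D 1%N) E, v \oc cx_d D 0 = u
    & forall n (u : mor (D n.+1) E), u \oc cx_d D n = 0 ->
        exists v : mor (D n.+2) E, v \oc cx_d D n.+1 = u].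

Section CxMaps.
Variables (Y : C) (D E : cocomplex C) (aug : mor Y (D 0%N)).
Hypothesis liftDE : forall n, lifts_to aug (E n).

(** Two consecutive components travel with their square, since the square is what permits the next
    lift. *)
Record cx_step n := CxStep {
  st_fst : mor (D n) (E n);
  st_snd : mor (D n.+1) (E n.+1);
  st_comm : st_snd \oc cx_d D n = cx_d E n \oc st_fst }.

Lemma cx_step_next n (s : cx_step n) :
  exists v : mor (D n.+2) (E n.+2), v \oc cx_d D n.+1 = cx_d E n.+1 \oc st_snd s.
Proof.
have [_ _] := liftDE n.+2; apply.
by rewrite -mcompA st_comm mcompA cx_dd mcomp0l.
Qed.

Fixpoint cx_steps (s : cx_step 0) n : cx_step n :=
  if n is n'.+1 then CxStep (projT2 (cid (cx_step_next (cx_steps s n')))) else s.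

Lemma cx_map_exists (aug' : mor Y (E 0%N)) : cx_d E 0 \oc aug' = 0 ->
  exists phi : cx_map D E, phi 0%N \oc aug = aug'.
Proof.
move=> daug'; have [h0 _ _] := liftDE 0; have [p0 p0aug] := h0 aug'.
have [_ h1 _] := liftDE 1.
have [|p1 p1d] := h1 (cx_d E 0 \oc p0); first by rewrite -mcompA p0aug.
pose s := cx_steps (CxStep p1d).
(* [st_fst (s n.+1)] reduces to [st_snd (s n)], so [st_comm] has the type of a chain map
   identity. *)
exists (@CxMap _ _ D E (fun n => st_fst (s n)) (fun n => st_comm (s n))).
exact: p0aug.
Qed.

(** The difference [d] is null-homotopic. A cocycle in one degree sees only two components of the
    homotopy, so existence in each degree suffices and no coherent family is chosen. *)
Lemma cx_map_unique (phi psi : cx_map D E) : phi 0%N \oc aug = psi 0%N \oc aug ->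
  forall n X (z : mor X (D n)), cx_d D n \oc z = 0 ->
  @is_coboundary _ (hom_complex X E) n (phi n \oc z - psi n \oc z).
Proof.
move=> eaug; pose d n := phi n - psi n.
have dd n : d n.+1 \oc cx_d D n = cx_d E n \oc d n.
  by rewrite mcompBl mcompBr !cm_comm.
have [_ h0 _] := liftDE 0.
have [|s0 hs0] := h0 (d 0%N); first by rewrite mcompBl eaug subrr.
have homotopy n : exists s : mor (D n.+1) (E n),
    (d n.+1 - cx_d E n \oc s) \oc cx_d D n = 0.
  elim: n => [|n [s hs]].
    by exists s0; rewrite mcompBl dd -mcompA hs0 subrr.
  have [_ _ /(_ _ _ hs) [s' hs']] := liftDE n.+1.
  exists s'; rewrite mcompBl dd -mcompA hs' mcompBr.
  by rewrite [in X in _ - (_ - X)]mcompA cx_dd mcomp0l subr0 subrr.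
case=> [|n] X z dz; rewrite -mcompBl -/(d _) /=.
  by rewrite -hs0 -mcompA dz mcomp0r.
have [s hs] := homotopy n; have [_ _ /(_ _ _ hs) [s' hs']] := liftDE n.+1.
exists (s \oc z); rewrite /postcomp mcompA.
apply/eqP; rewrite -subr_eq0 -mcompBl -hs' -mcompA dz mcomp0r //.
Qed.

Lemma coho_map_unique (phi psi : cx_map D E) X n : phi 0%N \oc aug = psi 0%N \oc aug ->
  @coho_map _ _ _ (hom_complex_map X phi) n =1 coho_map (hom_complex_map X psi) (n := n).
Proof.
move=> e; elim/quo_piW=> z; rewrite -/(coho_class z) !coho_mapE.
apply/coho_class_eq; apply: (cx_map_unique e); exact: (asboolW (sub_in z)).
Qed.

End CxMaps.

Definition cx_id (D : cocomplex C) : cx_map D D :=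
  @CxMap _ _ D D (fun n => idm (D n))
    (fun n => etrans (mcomp1l (cx_d D n)) (esym (mcomp1r (cx_d D n)))).

Fact cx_comp_comm (D E F : cocomplex C) (psi : cx_map E F) (phi : cx_map D E) n :
  (psi n.+1 \oc phi n.+1) \oc cx_d D n = cx_d F n \oc (psi n \oc phi n).
Proof. by rewrite -mcompA cm_comm mcompA cm_comm -mcompA. Qed.

Definition cx_comp (D E F : cocomplex C) (psi : cx_map E F) (phi : cx_map D E) :
  cx_map D F := CxMap (cx_comp_comm psi phi).

Lemma coho_map_retract (Y : C) (D E : cocomplex C) (aug : mor Y (D 0%N))
    (aug' : mor Y (E 0%N)) (phi : cx_map D E) (psi : cx_map E D) X n :
  (forall n, lifts_to aug (D n)) ->
  phi 0%N \oc aug = aug' -> psi 0%N \oc aug' = aug ->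
  cancel (@coho_map _ _ _ (hom_complex_map X phi) n)
    (coho_map (hom_complex_map X psi) (n := n)).
Proof.
move=> liftD ephi epsi; elim/quo_piW=> z; rewrite -/(coho_class z) !coho_mapE.
have e : cx_comp psi phi 0%N \oc aug = cx_id D 0%N \oc aug.
  by rewrite /= -mcompA ephi epsi mcomp1l.
have dz : cx_d D n \oc val z = 0 := asboolW (sub_in z).
apply/coho_class_eq; have /= := cx_map_unique liftD e dz.
by rewrite mcomp1l -mcompA.
Qed.

(** Lifting [aug] along [aug'] gives a chain map back; both composites agree with the identity on
    the augmentations, hence on cohomology. *)
Lemma coho_map_bij (Y : C) (D E : cocomplex C) (aug : mor Y (D 0%N))
    (aug' : mor Y (E 0%N)) (phi : cx_map D E) X n :
  (forall n, lifts_to aug (D n)) -> (forall n, lifts_to aug' (E n)) ->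
  (forall n, lifts_to aug' (D n)) ->
  cx_d D 0 \oc aug = 0 -> phi 0%N \oc aug = aug' ->
  bijective (@coho_map _ _ _ (hom_complex_map X phi) n).
Proof.
move=> DD EE ED daug ephi; have [psi epsi] := cx_map_exists ED daug.
exists (coho_map (hom_complex_map X psi) (n := n)).
  exact: coho_map_retract DD ephi epsi.
exact: coho_map_retract EE epsi ephi.
Qed.

End Comparison.

(** * Exactness of modules in terms of elements *)

Section ModExactness.
Variables (k : fieldType) (S : algType k).
Implicit Types X Y Z M : lmodType S^c.

Fact sub_incl_linear M (P : submod M) : linear (val : sub_mod P -> M).
Proof. by move=> c x y; rewrite linearP. Qed.
Definition sub_incl M (P : submod M) : modhom (sub_mod P) M :=
  ModHom (@sub_incl_linear M P).

Definition mod_ker X Y (f : modhom X Y) : submod X.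
Proof.
apply: (@Submod _ _ (fun x => f x = 0)).
- exact: linear0.
- by move=> x y hx hy /=; rewrite linearD /= hx hy addr0.
- by move=> c x hx /=; rewrite linearZ /= hx scaler0.
Defined.

Definition mod_im X Y (f : modhom X Y) : submod Y.
Proof.
apply: (@Submod _ _ (fun y => exists x, y = f x)).
- by exists 0; rewrite linear0.
- by move=> _ _ [x ->] [y ->]; exists (x + y); rewrite linearD.
- by move=> c _ [x ->]; exists (c *: x); rewrite linearZ.
Defined.

Lemma mod_mono_inj X Y (f : modhom X Y) : @mono k (Mod S) X Y f ->
  forall x, f x = 0 -> x = 0.
Proof.
move=> fm x fx.
have e : (sub_incl (mod_ker f) : modhom _ _) = mh_zero _ _.
  apply: (@mono0 k (Mod S) X Y f fm (sub_mod (mod_ker f)) (sub_incl _)).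
  by apply: modhomP => -[y py]; exact: (asboolW py).
exact: (congr1 (fun h : modhom _ _ => h (SubMod (asboolT (fx : mod_ker f x)))) e).
Qed.

Lemma mod_epi_surj X Y (f : modhom X Y) : @epi k (Mod S) X Y f ->
  forall y, exists x, y = f x.
Proof.
move=> fe y; pose pi : modhom Y (quo_mod (mod_im f)) := ModHom (@quo_pi_linear _ _ (mod_im f)).
have /(congr1 (fun h : modhom _ _ => h y)) : pi = mh_zero _ _.
  apply: (fe (quo_mod (mod_im f))); apply: modhomP => x /=.
  rewrite -(linear0 (quo_pi (mod_im f))).
  by apply/(quo_piP (mod_im f)); exists x; rewrite subr0.
rewrite /= -(linear0 (quo_pi (mod_im f))) => /(quo_piP (mod_im f)).
by rewrite subr0.
Qed.

(** The inclusion of the elementwise kernel of [g] factors through the abstract kernel [i], onto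
    which [e] is surjective. *)
Lemma mod_exactP X Y Z (f : modhom X Y) (g : modhom Y Z) :
  @exact_at k (Mod S) X Y Z f g -> forall y, g y = 0 -> exists x, y = f x.
Proof.
move=> [K [i [e [[gi kerP] epie ->]]]] y gy.
have [|v [iv _]] := kerP (sub_mod (mod_ker g)) (sub_incl _).
  by apply: modhomP => -[z pz]; exact: (asboolW pz).
pose y' : sub_mod (mod_ker g) := SubMod (asboolT (gy : mod_ker g y)).
have [x ex] := mod_epi_surj epie ((v : modhom _ _) y').
exists x; rewrite [RHS]/= -ex.
by have /(congr1 (fun h : modhom _ _ => h y')) := iv => /= ->.
Qed.

End ModExactness.

(** * Monomorphisms, kernels and injective objects in the Serre quotient *)

Section QuotientCategory.
Variables (k : fieldType) (S : algType k) (s : ideal S) (noeS : right_noetherian S).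
Local Notation Q := (QMod s noeS).
Local Notation qc := (qclass noeS).
Implicit Types W X Y Z E M : lmodType S^c.

Lemma qclass_eq0 X Y (f : frac s X Y) :
  qc f = 0 <-> mod_torsion s (fun=> True) (fun x => f x 0).
Proof.
rewrite (_ : 0 = qc (frac_hom s (mh_zero X Y))) //; split=> [/qclassP h|h].
  by apply: mod_torsion_weak h => // x [y [fy /= yE]]; rewrite yE in fy.
by apply/qclassP; apply: mod_torsion_weak h => // x fx; exists 0.
Qed.

Lemma qcomp_eq0 X Y Z (g : frac s Y Z) (f : frac s X Y) :
  qcomp (qc g) (qc f) = 0 <->
  mod_torsion s (fun=> True) (fun x => exists y, f x y /\ g y 0).
Proof. by rewrite qcompE; apply: qclass_eq0. Qed.

Lemma qclass_mono X Y (m : frac s X Y) : (forall x, m x 0 -> Gamma s x) ->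
  @mono k Q X Y (qc m).
Proof.
move=> hm W u v /eqP; rewrite -subr_eq0 -mcompBr => /eqP e; apply/subr0_eq.
move: (u - v) e; elim/qclassW=> w /(qcomp_eq0 m w) mw; apply/qclass_eq0.
apply: (mod_torsion_trans noeS _ _ mw).
- exact: fr_0.
- by move=> x y hx hy; rewrite -[0]addr0; apply: fr_D.
move=> x [y [wy /hm [p hp]]]; exists p => a /hp ya.
by rewrite -ya; apply: fr_Z.
Qed.

Definition frac_ker X Y (f : frac s X Y) : submod X.
Proof.
apply: (@Submod _ _ (fun x => f x 0)); first exact: fr_0.
- by move=> x y hx hy; rewrite -[0]addr0; apply: fr_D.
- by move=> c x hx; rewrite -(ract0l Y c); apply: fr_Z.
Defined.

Lemma qcomp_ker X Y (f : frac s X Y) :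
  qcomp (qc f) (qmap s noeS (sub_incl (frac_ker f))) = 0.
Proof.
apply/qcomp_eq0 => -[x px] _; exists 0%N => a _.
by exists (x *> a); split=> //; exact: (@sm_Z _ _ (frac_ker f) a x (asboolW px)).
Qed.

(** The test object is [frac_ker g], whose inclusion is killed by [g]. *)
Lemma qclass_kill_ker Y Z E (g : frac s Y Z) (u : frac s Y E) :
  (forall W (w : mor (C := Q) W Y), (qc g : mor (C := Q) Y Z) \oc w = 0 ->
    (qc u : mor (C := Q) Y E) \oc w = 0) ->
  mod_torsion s (fun y => g y 0) (fun y => u y 0).
Proof.
move=> h y gy; have := h _ _ (qcomp_ker g).
move=> /qcomp_eq0 /(_ (SubMod (asboolT (gy : frac_ker g y))) I) [p hp].
by exists p => a /hp [_ [/= -> ua]].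
Qed.

Lemma qmono_torsion X Y (m : frac s X Y) : @mono k Q X Y (qc m) ->
  forall x, m x 0 -> Gamma s x.
Proof.
move=> mm x /(qclass_kill_ker (u := frac_hom s (mh_id X)) _) -/(_ _) [].
  by move=> W w /(mono0 mm) ->; apply: mcomp0r.
by move=> p hp; exists p => a /hp.
Qed.

(* The class v is the extension along C0 <= Z of the relation u g^-1, where C0
   is its domain; the fibre of u g^-1 over 0 is torsion because u kills the
   kernel of g. *)
Lemma qfactor Y Z E (g : mor (C := Q) Y Z) (u : mor (C := Q) Y E) :
  injective_obj (E : Q) ->
  (forall W (w : mor (C := Q) W Y), g \oc w = 0 -> u \oc w = 0) ->
  exists v : mor (C := Q) Z E, v \oc g = u.
Proof.
elim/qclassW: g => g; elim/qclassW: u => u injE kill.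
have tors := qclass_kill_ker kill.
have @C0 : submod Z.
  apply: (@Submod _ _ (fun z => exists y e, g y z /\ u y e)).
  - by exists 0, 0; split; apply: fr_0.
  - move=> z z' [y [e [gy uy]]] [y' [e' [gy' uy']]].
    by exists (y + y'), (e + e'); split; apply: fr_D.
  - move=> a z [y [e [gy uy]]].
    by exists (y *> a), (e *> a); split; apply: fr_Z.
have @h0 : frac s (sub_mod C0) E.
  apply: (@Frac _ _ s (sub_mod C0) E (fun c e => exists y, g y (val c) /\ u y e)).
  - by exists 0; split; apply: fr_0.
  - move=> z e z' e' [y [gy uy]] [y' [gy' uy']].
    by exists (y + y'); split; apply: fr_D.
  - move=> z e a [y [gy uy]].
    by exists (y *> a); split; apply: fr_Z.
  - move=> [z pz] _; exists 0%N => a _.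
    have [y [e [gy uy]]] := asboolW pz.
    by exists (e *> a), (y *> a); split; apply: fr_Z.
  - apply: (mod_torsion_trans noeS (Q := u 0)).
    + by [].
    + by move=> x y -> ->; rewrite addr0.
    + move=> e [y [gy uy]]; have [p hp] := tors _ gy; exists p => a /hp ua.
      by have := fr_B (fr_Z a uy) ua; rewrite subrr subr0.
    exact: fr_fib.
(* The corestriction of [g] to [C0]; its domain contains every point where [g] and [u] are both
   defined. *)
have @g' : frac s Y (sub_mod C0).
  apply: (@Frac _ _ s Y (sub_mod C0) (fun y c => g y (val c))).
  - exact: fr_0.
  - by move=> *; apply: fr_D.
  - by move=> *; apply: fr_Z.
  - apply: mod_torsion_weak (mod_torsionI (fr_dom g) (fr_dom u)) => //.
    move=> y [[z gz] [e ue]].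
    by exists (SubMod (asboolT (ex_intro _ y (ex_intro _ e (conj gz ue)) : C0 z))).
  - move=> [z pz] /fr_fib [p hp]; exists p => a /hp za; exact: val_inj.
have [|v hv] := injE _ _ (qmap s noeS (sub_incl C0) : mor (C := Q) _ Z) _ (qc h0).
  apply: qclass_mono => c /= c0; exists 0%N => a _.
  by rewrite (_ : c = 0) ?ract0l //; apply: val_inj; apply: esym c0.
exists v; have -> : (qc g : mor (C := Q) Y Z) =
    (qmap s noeS (sub_incl C0) : mor (C := Q) _ Z) \oc (qc g' : mor (C := Q) Y _).
  apply: etrans (esym (qcompE _ _ _)); apply/esym/qclassP/frac_eqI => y z [c [gc _]].
  by exists (val c); split=> //; exists c.
rewrite mcompA hv; apply: etrans (qcompE _ _ _) _; apply/qclassP.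
apply: mod_torsion_weak (mod_torsionI (fr_dom g) (fr_dom u)) => // y [[z gz] [e ue]].
exists e; split=> //.
exists (SubMod (asboolT (ex_intro _ y (ex_intro _ e (conj gz ue)) : C0 z))).
by split=> //; exists y.
Qed.

Lemma lifts_to_injres (Y : Q) (J : injres Y) (E : Q) :
  injective_obj E -> lifts_to (ir_aug J) E.
Proof.
move=> injE; split.
- exact: (injE _ _ _ (ir_mono (i := J))).
- move=> u uaug; apply: qfactor => // W w hw.
  exact: exact_at_kill (ir_exact0 J) hw uaug.
- move=> n u ud; apply: qfactor => // W w hw.
  exact: exact_at_kill (ir_exact J n) hw ud.
Qed.

(** Up to torsion [w] takes values in the kernel of [g], hence in the image of [f], where [u]
    vanishes up to torsion. Thus exactness on elements suffices. *)
Lemma qmap_kill W X Y Z E (f : modhom X Y) (g : modhom Y Z)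
    (w : mor (C := Q) W Y) (u : mor (C := Q) Y E) :
  (forall y, g y = 0 -> exists x, y = f x) ->
  (qmap s noeS g : mor (C := Q) Y Z) \oc w = 0 ->
  u \oc (qmap s noeS f : mor (C := Q) X Y) = 0 -> u \oc w = 0.
Proof.
elim/qclassW: w => w; elim/qclassW: u => u ex /qcomp_eq0 gw /qcomp_eq0 uf.
apply/qcomp_eq0; apply: (mod_torsion_trans noeS _ _ gw).
- by exists 0; split; apply: fr_0.
- move=> a b [y [wy uy]] [y' [wy' uy']]; exists (y + y').
  by split; [apply: fr_D|rewrite -[0]addr0; apply: fr_D].
move=> a [y [way /esym /ex [x ey]]]; have [p hp] := uf x I.
exists p => b /hp [_ [-> ub]]; exists (y *> b); split; first exact: fr_Z.
by rewrite ey -mh_ract.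
Qed.

Lemma lifts_to_qmap M (D : cocomplex (Mod S)) (aug : modhom M (D 0%N)) (E : Q) :
  (forall x, aug x = 0 -> x = 0) ->
  (forall y, (cx_d D 0 : modhom _ _) y = 0 -> exists x, y = aug x) ->
  (forall n y, (cx_d D n.+1 : modhom _ _) y = 0 ->
     exists x, y = (cx_d D n : modhom _ _) x) ->
  injective_obj E ->
  @lifts_to k Q M (fmap_cx (qfunctor s noeS) D) (fmap (qfunctor s noeS) aug) E.
Proof.
move=> aug_inj ex0 ex injE; split.
- apply: injE; apply: qclass_mono => x /esym /aug_inj ->; exists 0%N => a _; exact: ract0l.
- move=> u uaug; apply: qfactor => // W w hw; exact: qmap_kill ex0 hw uaug.
- move=> n u ud; apply: qfactor => // W w hw; exact: qmap_kill (ex n) hw ud.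
Qed.

End QuotientCategory.

(** * Artin-Rees and Baer's criterion modulo torsion *)

(** A linear map from a submodule of [Y] to a quotient of [E], encoded by its graph as in [frac] but
    without the torsion conditions. *)
Record linrel (S : nzRingType) (Y E : lmodType S^c) := Linrel {
  lr :> Y -> E -> Prop;
  lr_0 : lr 0 0;
  lr_D : forall y e y' e', lr y e -> lr y' e' -> lr (y + y') (e + e');
  lr_Z : forall y e a, lr y e -> lr (y *> a) (e *> a) }.

Section Baer.
Variables (S : nzRingType) (s : ideal S).
Hypothesis noeS : right_noetherian S.

Lemma lr_B (Y E : lmodType S^c) (G : linrel Y E) y e y' e' :
  G y e -> G y' e' -> G (y - y') (e - e').
Proof.
move=> h /(lr_Z (-1)) h'; have := lr_D h h'.
by rewrite /ract (_ : (-1 : S) = (-1 : S^c)) // !scaleN1r.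
Qed.

Lemma Gamma_D (E : lmodType S^c) (x y : E) : Gamma s x -> Gamma s y -> Gamma s (x + y).
Proof.
move=> [n hn] [m hm]; exists (maxn n m) => a sa; rewrite ractDl.
rewrite hn ?hm ?addr0 //; apply: ideal_pow_leq sa; [exact: leq_maxr|exact: leq_maxl].
Qed.

Lemma Gamma_mul_pow n (E : lmodType S^c) (x : E) :
  (forall a, ideal_pow s n a -> Gamma s (x *> a)) -> Gamma s x.
Proof.
move=> h.
have [||||p hp] := @mod_torsion_trans _ s noeS E (fun y => y = x)
  (fun y => Gamma s y) (fun y => y = 0) _ _ _ _ x erefl.
- by [].
- by move=> y z -> ->; rewrite addr0.
- by move=> _ ->; exists n.
- by move=> y [p hp]; exists p.
- by exists p.
Qed.

Hypothesis arS : right_artin_rees s.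

(** Induction on [n]: the Artin-Rees property is applied to the right ideal [c s^n], which already
    contains the elements of [c] lying in a high power of [s]. *)
Lemma artin_rees_pow c n : right_ideal c -> exists N, forall x,
  c x -> ideal_pow s N x -> ideal_mul c (ideal_pow s n) x.
Proof.
move=> hc; elim: n => [|n [N IH]].
  by exists 0%N => x cx _; rewrite -[x]mulr1; apply: ideal_mul1.
have [N' hN'] := arS (ideal_mul_right c (ideal_pow_right s n)).
exists (maxn N N') => x cx sx.
have [|m [a [b [ha hb ->]]]] := hN' x (IH _ cx (ideal_pow_leq (leq_maxl _ _) sx)).
  exact: ideal_pow_leq (leq_maxr _ _) sx.
elim/big_ind: _ => [||i _]; [exact: ideal_mul_0|exact: ideal_mul_add|].
have [p [u [v [hu hv ->]]]] := ha i.
exists p, u, (fun j => v j * b i); split=> // [j|]; first exact: (ideal_mul1 (hv j) (hb i)).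
by rewrite mulr_suml; apply: eq_bigr => j _; rewrite mulrA.
Qed.

Variable E : lmodType S^c.

(* Artin-Rees for the submodule K of S^m: the intersection of K with (s^N)^m
   lies in K s^n, which eps kills once n bounds the torsion of eps(K); the
   induction is on the set of coordinates supporting K. *)
Lemma torsion_image_kill m (eps : {linear {ffun 'I_m -> S^c^o} -> E}) (gs : seq 'I_m)
    (K : submod {ffun 'I_m -> S^c^o}) :
  (forall v, K v -> forall i, i \notin gs -> v i = 0) ->
  (forall v, K v -> Gamma s (eps v)) ->
  exists N, forall v, K v -> (forall i, ideal_pow s N (v i : S)) -> eps v = 0.
Proof.
elim: gs K => [|g gs IH] K supp tors.
  exists 0%N => v Kv _; rewrite (_ : v = 0) ?linear0 //.
  by apply/ffunP => i; rewrite (supp v) // ffunE.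
(* The right ideal of [g]-th coordinates of [K]; its generators lift to vectors [u i] of [K]. *)
pose c (a : S) := exists2 v, K v & v g = a.
have hc : right_ideal c.
  split; first by exists 0; rewrite ?ffunE //; apply: sm_0.
    by move=> _ _ [v Kv <-] [w Kw <-]; exists (v + w); rewrite ?ffunE //; apply: sm_D.
  by move=> _ a [v Kv <-]; exists (v *> a); rewrite ?ffunE //; apply: sm_Z.
have [l [r [cr genr]]] := noeS hc.
have /choice [u hu] : forall i, exists u, K u /\ u g = r i.
  by move=> i; have [v Kv vg] := cr i; exists v.
have /choice [f hf] : forall i, exists n, forall x, ideal_pow s n x -> eps (u i) *> x = 0.
  by move=> i; apply: tors; case: (hu i).
pose n1 := (\max_(i < l) f i)%N.
have hn1 i x : ideal_pow s n1 x -> eps (u i) *> x = 0.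
  by move=> sx; apply: hf; apply: ideal_pow_leq sx; apply: leq_bigmax.
have @K' : submod {ffun 'I_m -> S^c^o}.
  apply: (@Submod _ _ (fun v => K v /\ v g = 0)).
  - by split; [apply: sm_0|rewrite ffunE].
  - move=> x y [Kx xg] [Ky yg].
    by split; [apply: sm_D|rewrite ffunE xg yg addr0].
  - move=> a x [Kx xg].
    by split; [apply: sm_Z|rewrite ffunE xg scaler0].
have [||N' hN'] := IH K'.
- move=> v [Kv vg] i; have [->//|ng] := eqVneq i g.
  by move=> hi; apply: supp => //; rewrite inE negb_or ng.
- by move=> v [Kv _]; apply: tors.
(* The exponent [n1] makes [eps (u j) *> a j] vanish, and [N'] keeps the remainder [w], whose
   coordinate [g] is cleared, within reach of [hN']. *)
have [N hN] := artin_rees_pow (maxn n1 N') hc.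
exists (maxn N N') => v Kv sv.
have [|p [y [b [cy hb vg]]]] := hN (v g) _ (ideal_pow_leq (leq_maxl _ _) (sv g)).
  by exists v.
have /choice [d hd] : forall t, exists d : 'I_l -> S, y t = \sum_(j < l) r j * d j.
  by move=> t; apply: genr.
pose a j := \sum_(t < p) d t j * b t.
have sa j : ideal_pow s (maxn n1 N') (a j).
  by apply: ideal_pow_sum => t; apply: ideal_pow_mull.
have va : v g = \sum_(j < l) (u j g : S) * a j.
  rewrite vg; under eq_bigr do rewrite hd mulr_suml.
  rewrite exchange_big; apply: eq_bigr => j _; case: (hu j) => _ ->.
  by rewrite mulr_sumr; apply: eq_bigr => t _; rewrite mulrA.
pose w := v - \sum_(j < l) u j *> a j.
have wE i : w i = v i - \sum_(j < l) (u j i : S) * a j.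
  rewrite /w !ffunE sum_ffunE; congr (_ - _).
  by apply: eq_bigr => j _; rewrite ffunE.
have Ku : K (\sum_(j < l) u j *> a j).
  elim/big_ind: _ => [||j _]; [exact: sm_0|exact: sm_D|].
  by apply: sm_Z; case: (hu j).
have w0 : eps w = 0.
  apply: hN' => [|i].
    split; first by apply: sm_B.
    by rewrite wE va subrr.
  rewrite wE; have [_ sD sM] := ideal_pow_right s N'.
  have sv' := ideal_pow_leq (leq_maxr N _) (sv i).
  apply: sD => //; rewrite -mulN1r; apply: ideal_pow_mull; apply: ideal_pow_sum => j.
  by apply: ideal_pow_mull; apply: ideal_pow_leq (sa j); apply: leq_maxr.
rewrite -(subrK (\sum_(j < l) u j *> a j) v) linearD -/w w0 add0r linear_sum big1 // => j _.
by rewrite linear_ract hn1 //; apply: ideal_pow_leq (sa j); apply: leq_maxl.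
Qed.

(* Baer's criterion for E, a homomorphism from a right ideal to E being given
   by its graph *)
Definition baer := forall Psi : linrel (S^c^o : lmodType S^c) E,
  (forall e, Psi 0 e -> e = 0) -> exists e, forall z e', Psi z e' -> e' = e *> (z : S).

(* Baer's criterion for E / Gamma E, where G is the preimage in S x E of the graph
   of a map from a right ideal c to E / Gamma E: for large N, lifting the values
   on generators of c gives a well-defined map from c s^N to E. *)
Lemma baer_quotient : baer -> forall G : linrel (S^c^o : lmodType S^c) E,
  (forall e, G 0 e -> Gamma s e) ->
  exists e, forall z e', G z e' -> Gamma s (e' - e *> (z : S)).
Proof.
move=> hE G tors; pose c (a : S) := exists e, G a e.
have hc : right_ideal c.
  split; first by exists 0; apply: lr_0.
    by move=> x y [e he] [e' he']; exists (e + e'); apply: lr_D.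
  by move=> x a [e he]; exists (e *> a); exact: (lr_Z a he).
have [m [x [cx genx]]] := noeS hc.
have {cx} /choice [f hf] := cx.
pose eps0 (v : {ffun 'I_m -> S^c^o}) := \sum_(i < m) f i *> (v i : S).
have eps0_linear : linear eps0.
  move=> a v w; rewrite /eps0 scaler_sumr -big_split; apply: eq_bigr => i _ /=.
  by rewrite !ffunE ractD; congr (_ + _); apply: ractM.
pose epsL := GRing.isLinear.Build _ _ _ _ eps0 eps0_linear.
pose eps : {linear {ffun 'I_m -> S^c^o} -> E} := HB.pack eps0 epsL.
pose pi (v : {ffun 'I_m -> S^c^o}) : S := \sum_(i < m) x i * (v i : S).
have piD v w : pi (v + w) = pi v + pi w.
  by rewrite /pi -big_split; apply: eq_bigr => i _; rewrite ffunE mulrDr.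
have piZ v a : pi (a *: v) = pi v * a.
  by rewrite /pi mulr_suml; apply: eq_bigr => i _; rewrite ffunE -mulrA.
have pi0 : pi 0 = 0 by rewrite /pi big1 // => i _; rewrite ffunE mulr0.
have Geps v : G (pi v) (eps v).
  rewrite /pi /= /eps0; elim/big_ind2: _ => [||i _]; [exact: lr_0|by move=> *; apply: lr_D|].
  exact: (lr_Z (v i : S) (hf i)).
(* The relations among the generators [x]; [eps] sends them to torsion since they lie over 0 in
   [G]. *)
have @K : submod {ffun 'I_m -> S^c^o}.
  apply: (@Submod _ _ (fun v => pi v = 0)) => //.
  - by move=> v w hv hw; rewrite piD hv hw addr0.
  - by move=> a v hv; rewrite piZ hv mul0r.
have [||N hN] := @torsion_image_kill m eps (enum 'I_m) K.
- by move=> v _ i; rewrite mem_enum.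
- by move=> v Kv; apply: tors; rewrite -(Kv : pi v = 0).
(* By [hN], relations with coefficients in [s^N] are killed by [eps], which makes [Psi]
   single-valued. *)
have @Psi : linrel (S^c^o : lmodType S^c) E.
  apply: (@Linrel S S^c^o E (fun z e => exists v : {ffun 'I_m -> S^c^o},
    [/\ forall i, ideal_pow s N (v i : S), z = pi v & e = eps v])).
  - exists 0; split; [|by rewrite pi0|by rewrite linear0].
    by move=> i; rewrite ffunE; case: (ideal_pow_right s N).
  - move=> z e z' e' [v [sv -> ->]] [v' [sv' -> ->]]; exists (v + v').
    split; [|by rewrite piD|by rewrite linearD].
    by move=> i; rewrite ffunE; case: (ideal_pow_right s N) => _ + _; apply.
  - move=> z e a [v [sv -> ->]]; exists (v *> a).
    split; [|by rewrite piZ|by rewrite linear_ract].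
    by move=> i; rewrite ffunE; apply: ideal_pow_mulr.
have [e0 he0] : exists e, forall z e', Psi z e' -> e' = e *> (z : S).
  by apply: hE => e [v [sv pv ->]]; apply: hN.
exists e0 => z e' Gz; have [w zw] := genx z (ex_intro _ _ Gz).
pose v : {ffun 'I_m -> S^c^o} := [ffun i => w i].
have zv : z = pi v by rewrite zw; apply: eq_bigr => i _; rewrite ffunE.
(* The element [e' - eps v] lies over 0 in [G], and [eps v - e0 *> z] is killed by [s^N], because
   [v *> b] has entries in [s^N] for [b] in [s^N]. *)
rewrite -(subrK (eps v) e') -addrA; apply: Gamma_D.
  by apply: tors; rewrite -(subrr z) {2}zv; apply: lr_B.
exists N => b sb; rewrite ractBl -ractM.
apply/eqP; rewrite subr_eq0; apply/eqP.
apply: he0; exists (v *> b); split; [|by rewrite zv piZ|by rewrite linear_ract].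
by move=> i; rewrite ffunE; apply: ideal_pow_mull.
Qed.

(** The argument of Baer's criterion with values modulo torsion: Zorn's lemma gives a maximal
    extension with torsion fibre over 0, and [baer_quotient] adjoins any further element to its
    domain. *)
Lemma torsion_extend (Y : lmodType S^c) (G0 : linrel Y E) : baer ->
  (forall e, G0 0 e -> Gamma s e) ->
  exists G : linrel Y E, [/\ forall y e, G0 y e -> G y e,
    forall e, G 0 e -> Gamma s e & forall y, exists e, G y e].
Proof.
move=> hE tors0.
pose T := {G : linrel Y E | (forall y e, G0 y e -> G y e) /\ (forall e, G 0 e -> Gamma s e)}.
pose le (G H : T) := `[< forall y e, sval G y e -> sval H y e >].
have G0T : T by exists G0.
have [|||[G [sG tG]] Gmax] := ZL_preorder G0T (R := le).
- by move=> G; apply/asboolP.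
- by move=> G H K /asboolP h1 /asboolP h2; apply/asboolP => y e /h1 /h2.
(* The empty chain is bounded by [G0T], a nonempty one by its union. *)
- move=> A Atot; have [[G1 AG1]|nA] := pselect (exists G, A G); last first.
    by exists G0T => G AG; case: nA; exists G.
  have @U : linrel Y E.
    apply: (@Linrel _ _ _ (fun y e => exists2 G, A G & sval G y e)).
    + by exists G1 => //; apply: lr_0.
    + move=> y e y' e' [G AG Gy] [H AH Hy].
      case: (Atot _ _ AG AH) => /asboolP h; [exists H|exists G] => //;
        apply: lr_D => //; exact: h.
    + by move=> y e a [G AG Gy]; exists G => //; apply: lr_Z.
  have UP : (forall y e, G0 y e -> U y e) /\ (forall e, U 0 e -> Gamma s e).
    split; first by move=> y e h; exists G1 => //; apply: (svalP G1).1.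
    by move=> e [G AG]; apply: (svalP G).2.
  by exists (exist _ U UP) => G AG; apply/asboolP => y e h; exists G.
exists G; split=> // y.
(* The pullback of [G] along [a |-> y *> a], defined on the right ideal of those [a] with [y *> a]
   in the domain of [G]. *)
have @Gy : linrel (S^c^o : lmodType S^c) E.
  apply: (@Linrel S S^c^o E (fun a e => G (y *> (a : S)) e)).
  - by rewrite ract0; apply: lr_0.
  - by move=> a e a' e' h h'; rewrite ractD; apply: lr_D.
  - by move=> a e b h; rewrite ractM; apply: lr_Z.
have [e0 he0] : exists e, forall z e', Gy z e' -> Gamma s (e' - e *> (z : S)).
  by apply: baer_quotient => // e; rewrite /= ract0; apply: tG.
(* [G] enlarged by the pair [(y, e0)]; the choice of [e0] keeps the fibre over 0 torsion. *)
have @H : linrel Y E.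
  apply: (@Linrel _ _ _ (fun z e => exists (a : S) z' e',
    [/\ G z' e', z = z' + y *> a & e = e' + e0 *> a])).
  - by exists 0, 0, 0; rewrite !ract0 !addr0; split=> //; apply: lr_0.
  - move=> z e w f [a [z' [e' [Gz -> ->]]]] [b [w' [f' [Gw -> ->]]]].
    exists (a + b), (z' + w'), (e' + f').
    by rewrite !ractD !(addrACA _ (_ *> a)); split=> //; apply: lr_D.
  - move=> z e b [a [z' [e' [Gz -> ->]]]].
    by exists (a * b), (z' *> b), (e' *> b); rewrite !ractDl !ractM; split=> //; apply: lr_Z.
have GH z e : G z e -> H z e.
  by move=> Gz; exists 0, z, e; rewrite !ract0 !addr0.
have HP : (forall y e, G0 y e -> H y e) /\ (forall e, H 0 e -> Gamma s e).
  split=> [z e /sG /GH //|e [a [z' [e' [Gz z0 ->]]]]].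
  have /he0 : Gy (- a : S) e'.
    rewrite /= (_ : y *> - a = z') //; apply: (addIr (y *> a)).
    by rewrite -ractD addNr ract0.
  by rewrite /ract scaleNr opprK.
exists e0; apply: (asboolW (Gmax (exist _ H HP) (asboolT GH))).
by exists 1, 0, 0; rewrite !ract1 !add0r; split=> //; apply: lr_0.
Qed.

End Baer.

(** * Finite families and averaging over the group *)

Lemma mod_torsion_forall (I : finType) (S : nzRingType) (s : ideal S)
    (M : lmodType S^c) (P : M -> Prop) (Q : I -> M -> Prop) :
  (forall i, mod_torsion s P (Q i)) -> mod_torsion s P (fun m => forall i, Q i m).
Proof.
move=> h m Pm; have /choice [f hf] := fun i => h i m Pm.
exists (\max_i f i)%N => x sx i; apply: hf; apply: ideal_pow_leq sx.
exact: leq_bigmax.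
Qed.

Lemma ract_bigsum (S : nzRingType) (M : lmodType S^c) (I : finType) (m : M) (a : I -> S) :
  m *> (\sum_i a i) = \sum_i m *> a i.
Proof. exact: scaler_suml. Qed.

Lemma ract_bigsuml (S : nzRingType) (M : lmodType S^c) (I : finType) (m : I -> M) (a : S) :
  (\sum_i m i) *> a = \sum_i m i *> a.
Proof. exact: scaler_sumr. Qed.

Section Averaging.
Variables (k : fieldType) (gT : finGroupType) (V : lmodType k) (rho : right_action gT V).

Definition ravg (v : V) : V := (#|gT|%:R)^-1 *: \sum_(g : gT) rho g v.

Lemma ravg_invariant v h : rho h (ravg v) = ravg v.
Proof.
rewrite linearZ linear_sum; congr (_ *: _).
rewrite [RHS](reindex_inj (mulIg h)); apply: eq_bigr => g _ /=.
by rewrite ra_M.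
Qed.

Lemma ravg_id v : (#|gT|%:R : k) != 0 -> (forall g, rho g v = v) -> ravg v = v.
Proof.
move=> nz h; rewrite /ravg (eq_bigr (fun=> v)) // sumr_const.
by rewrite cardT -cardE -scaler_nat scalerA mulVf // scale1r.
Qed.

End Averaging.

(** * Extension of fractions and injectivity in the quotient *)

Section FracExtend.
Variables (k : fieldType) (S : algType k) (s : ideal S) (noeS : right_noetherian S).
Hypothesis arS : right_artin_rees s.

(** The relation [f m^-1] has torsion fibre over 0, so [torsion_extend] makes it total. The
    condition on [m] concerns elements, so that [injective_quotient] can apply this to
    [forget m]. *)
Lemma frac_extend (X Y E : lmodType S^c) (m : frac s X Y) (f : frac s X E) :
  baer E -> (forall x, m x 0 -> Gamma s x) ->
  exists h : frac s Y E, qcomp (qclass noeS h) (qclass noeS m) = qclass noeS f.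
Proof.
move=> hE hm.
have @G0 : linrel Y E.
  apply: (@Linrel S Y E (fun y e => exists x, m x y /\ f x e)).
  - by exists 0; split; apply: fr_0.
  - move=> y e y' e' [x [mx fx]] [x' [mx' fx']].
    by exists (x + x'); split; apply: fr_D.
  - by move=> y e a [x [mx fx]]; exists (x *> a); split; apply: fr_Z.
have [|G [sG tG totG]] := @torsion_extend S s noeS arS E Y G0 hE.
  move=> e [x [/hm [p hp] fx]]; apply: (Gamma_mul_pow noeS (n := p)) => a /hp xa.
  have : f 0 (e *> a) by rewrite -xa; apply: fr_Z.
  by case/fr_fib => q hq; exists q.
have @h : frac s Y E.
  apply: (@Frac _ _ s Y E G); [exact: lr_0|exact: lr_D|exact: lr_Z| |exact: tG].
  by move=> y _; exists 0%N => a _; apply: totG.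
exists h; rewrite qcompE; apply/qclassP.
apply: mod_torsion_weak (mod_torsionI (fr_dom m) (fr_dom f)) => // x [[y my] [e fe]].
by exists e; split=> //; exists y; split=> //; apply: sG; exists x.
Qed.

Lemma qinjective (E : lmodType S^c) : baer E -> injective_obj (E : QMod s noeS).
Proof.
move=> hE X Y; elim/qclassW=> m /qmono_torsion hm; elim/qclassW=> f.
by have [h eh] := frac_extend f hE hm; exists (qclass noeS h).
Qed.

End FracExtend.

(** * Modules over the skew group algebra and their restrictions to [R] *)

Section SkewModules.
Variables (k : fieldType) (gT : finGroupType) (R : algType k).
Variable act : modalg_action gT R.
Local Notation B := (skewalg act).
Local Notation r := (Gradical act).
Local Notation b := (skew_radical act).
Implicit Types N M E X Y : lmodType B^c.

Lemma skew_decomp (x : B) : x = \sum_g skew_embed act (x g) * skew_elt act g.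
Proof.
apply/ffunP => h; rewrite sum_ffunE (bigD1 h) //= skew_embedMl ffunE eqxx mulr1.
rewrite big1 ?addr0 // => g ng.
by rewrite skew_embedMl ffunE eq_sym (negPf ng) mulr0.
Qed.

Lemma ract_decomp M (m : M) (x : B) :
  m *> x = \sum_g gract ((m : restr M) *> x g : M) g.
Proof.
rewrite {1}[x]skew_decomp ract_bigsum; apply: eq_bigr => g _.
by rewrite ractM.
Qed.

Lemma gract_ract M (m : M) h (x : B) :
  gract m h *> x = \sum_g gract ((m : restr M) *> act h (x (h^-1 * g)%g) : M) g.
Proof.
rewrite /gract -ractM ract_decomp; apply: eq_bigr => g _.
by rewrite skew_eltMl.
Qed.

(* An R-linear map psi on a right ideal c of R extends to the B-linear map
   c B -> E sending the sum of the z_g \ox g to the sum of the psi(z_g) g. *)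
Lemma baer_restr E : @injective_obj k (Mod B) E -> baer (restr E).
Proof.
move=> injE Psi Psi0.
have PsiU z e e' : Psi z e -> Psi z e' -> e = e'.
  move=> h h'; apply/subr0_eq/Psi0; rewrite -(subrr z); exact: lr_B.
(* [psi] is the function with graph [Psi], its values outside the domain c being arbitrary. *)
have /choice [psi psiP] : forall z, exists e' : restr E, (exists e, Psi z e) -> Psi z e'.
  move=> z; case: (pselect (exists e, Psi z e)) => [[e he]|n].
    by exists e.
  by exists 0.
have psiE z e : Psi z e -> psi z = e.
  by move=> h; exact: (PsiU _ _ _ (psiP z (ex_intro _ e h)) h).
(* The right ideal c B: all coefficients lie in the domain c of [Psi]. *)
have @D : submod (B^c^o : lmodType B^c).
  apply: (@Submod B^c B^c^o (fun x => forall g, exists e, Psi ((x : B) g) e)).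
  - by move=> g; exists 0; rewrite ffunE; apply: lr_0.
  - move=> x y hx hy g; have [e he] := hx g; have [e' he'] := hy g.
    by exists (e + e'); rewrite ffunE; apply: lr_D.
  - move=> a x hx g; suff : exists e, Psi (((x : B) * (a : B)) g) e by [].
    rewrite skewM.
    elim/big_ind: _ => [|z z' [e he] [e' he']|h _].
    + by exists 0; apply: lr_0.
    + by exists (e + e'); apply: lr_D.
    + by have [e he] := hx h; eexists; apply: lr_Z he.
pose phi0 (x : sub_mod D) : E := \sum_g gract (psi ((val x : B) g) : E) g.
have PsiD (x : sub_mod D) g : Psi ((val x : B) g) (psi ((val x : B) g)).
  exact/psiP/(asboolW (sub_in x)).
have PsiDg (u v : B) g e e' : Psi (u g) e -> Psi (v g) e' -> Psi ((u + v) g) (e + e').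
  by rewrite skewD; apply: lr_D.
have PsiMg (u v : B) g (f : gT -> restr E) : (forall h, Psi (u h) (f h)) ->
    Psi ((u * v) g) (\sum_h f h *> act h (v (h^-1 * g)%g)).
  move=> hf; rewrite skewM; elim/big_ind2: _ => [|*|h _]; [exact: lr_0|exact: lr_D|].
  exact: lr_Z.
have phi0_linear : linear phi0.
  move=> a x y.
  have valE : val (a *: x + y) = (val x : B) * (a : B) + (val y : B) :> B.
    exact: (linearP (val : sub_mod D -> _)).
  rewrite /phi0 valE; transitivity ((\sum_g gract (psi ((val x : B) g) : E) g) *> (a : B) +
     \sum_g gract (psi ((val y : B) g) : E) g); last by [].
  rewrite ract_bigsuml; under [in RHS]eq_bigr do rewrite gract_ract.
  rewrite exchange_big -big_split; apply: eq_bigr => g _ /=.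
  rewrite -[LHS](_ : gract (\sum_h (psi ((val x : B) h) : restr E) *>
     act h ((a : B) (h^-1 * g)%g) + psi ((val y : B) g) : E) g = _).
    by rewrite gractD /gract ract_bigsuml.
  congr (gract _ g); apply/esym/psiE.
  have Mg := PsiMg (val x : B) (a : B) g _ (PsiD x).
  exact: (PsiDg ((val x : B) * (a : B)) (val y : B) g _ _ Mg (PsiD y g)).
pose phi : modhom (sub_mod D) E := ModHom phi0_linear.
have mono_incl : @mono k (Mod B) _ _ (sub_incl D).
  move=> W u v e; apply: modhomP => w; apply: val_inj.
  exact: (congr1 (fun f : modhom _ _ => f w) e).
have [h hphi] := injE _ _ _ mono_incl phi.
(* The extension [h] is the map [x |-> h 1 *> x]. *)
exists ((h : modhom _ _) 1) => z e Pze.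
have Dz : D (skew_embed act z).
  move=> g; rewrite ffunE; case: ifP => _; first by exists e.
  by exists 0; apply: lr_0.
have := congr1 (fun f : modhom _ _ => f (SubMod (asboolT Dz))) hphi.
rewrite /= /phi0 (bigD1 1%g) //= ffunE eqxx gract1 (psiE _ _ Pze) big1 ?addr0; last first.
  move=> g ng; rewrite ffunE (negPf ng) (psiE 0 0) ?gract0 //; exact: lr_0.
move=> <-; rewrite restr_ract -mh_ract; congr (_ _).
exact: (esym (mul1r (skew_embed act z))).
Qed.

Lemma skew_embed_pow n x : ideal_pow r n x -> ideal_pow b n (skew_embed act x).
Proof.
elim: n x => [//|n IH] _ [p [u [v [hu hv ->]]]].
exists p, (fun i => skew_embed act (u i)), (fun i => skew_embed act (v i)).
split=> [i|i g|]; first exact: (IH _ (hu i)).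
  rewrite ffunE; case: ifP => _; [exact: hv|exact: Gradical_0].
rewrite (big_morph (skew_embed act) (id1 := 0) (op1 := +%R)).
- by apply: eq_bigr => i _; rewrite skew_embedM.
- by move=> y z; have := skew_embed_linear act 1 y z; rewrite !scale1r.
- by apply/ffunP => h; rewrite !ffunE if_same.
Qed.

(** Products stay in the powers of [r] because [r] is [G]-stable. With [skew_embed_pow] this makes
    [b^n] equal to [r^n \ox kG]. *)
Lemma skew_pow_coef n (x : B) g : ideal_pow b n x -> ideal_pow r n (x g).
Proof.
elim: n x g => [//|n IH] _ g [p [u [v [hu hv ->]]]].
have rD := ideal_pow_right r n.+1.
rewrite skew_sum; apply: ideal_pow_sum => i; rewrite skewM.
have [h0 hD _] := rD.
elim/big_ind: _ => // h _; apply: ideal_mul1; first exact: (IH _ _ (hu i)).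
exact: (Gradical_stable h (hv i _)).
Qed.

Lemma mod_torsion_restr M (P Q : M -> Prop) :
  mod_torsion b P Q -> mod_torsion r (M := restr M) P Q.
Proof.
move=> h m /h [n hn]; exists n => x /skew_embed_pow /hn; exact.
Qed.

(** An element of [b^n] acts as a sum of maps [m |-> (m x_g) g] with [x_g] in [r^n], whence the
    closure conditions on [Q]. *)
Lemma mod_torsion_skew M (P Q : M -> Prop) :
  Q 0 -> (forall x y, Q x -> Q y -> Q (x + y)) ->
  (forall x g, Q x -> Q (gract x g)) ->
  mod_torsion r (M := restr M) P Q -> mod_torsion b P Q.
Proof.
move=> Q0 QD Qg h m /h [n hn]; exists n => x sx; rewrite ract_decomp.
by elim/big_ind: _ => // g _; apply/Qg/hn/skew_pow_coef.
Qed.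

Section Forget.
Variables N M : lmodType B^c.

Definition forget (f : frac b N M) : frac r (restr N) (restr M).
Proof.
apply: (@Frac k R r (restr N) (restr M) f).
- exact: (fr_0 f).
- exact: (@fr_D _ _ _ _ _ f).
- by move=> n m a; apply: (@fr_Z _ _ _ _ _ f).
- exact: (mod_torsion_restr (@fr_dom _ _ _ _ _ f)).
- exact: (mod_torsion_restr (@fr_fib _ _ _ _ _ f)).
Defined.

Lemma forget_gract (f : frac b N M) n m g : f n m -> f (gract n g) (gract m g).
Proof. exact: fr_Z. Qed.

Lemma forget_eq (f f' : frac b N M) : frac_eq (forget f) (forget f') <-> frac_eq f f'.
Proof.
split=> [|h]; last exact: (mod_torsion_restr h).
apply: mod_torsion_skew.
- by exists 0; split; apply: fr_0.
- by move=> x y [m [? ?]] [m' [? ?]]; exists (m + m'); split; apply: fr_D.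
- by move=> x g [m [? ?]]; exists (gract m g); split; apply: forget_gract.
Qed.

End Forget.

Variable noeR : right_noetherian R.
Local Notation noeB := (skew_right_noetherian (act := act) noeR).
Local Notation QB := (QMod b noeB).
Local Notation QR := (QMod r noeR).
Local Notation F := (res_quotient act noeR).

(** Restriction of scalars on the quotient categories. The lemmas below show that on Hom spaces it
    is injective with the [G]-invariants as image. *)
Definition qforget N M (q : mor (C := QB) N M) : mor (F N) (F M) :=
  qclass noeR (forget (qrepr q)).

Lemma qforgetE N M (f : frac b N M) :
  qforget (qclass noeB f) = qclass noeR (forget f).
Proof. by apply/qclassP/forget_eq/qreprP. Qed.

Lemma qforget_inj N M : injective (@qforget N M).
Proof.
elim/qclassW=> f; elim/qclassW=> g; rewrite (qforgetE f) (qforgetE g).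
by move=> /qclassP /forget_eq e; apply/qclassP.
Qed.

Fact qforget_linear N M : linear (@qforget N M).
Proof.
move=> c; elim/qclassW=> f; elim/qclassW=> g.
rewrite (qforgetE f) (qforgetE g) qclass_scale qclass_add.
apply: etrans (qforgetE _) _; rewrite qclass_scale qclass_add.
apply/qclassP/frac_eqI => n m fm; exists m; split=> //.
case: fm => [_ [e [[d [fd ->]] ge ->]]].
exists (d *> c%:A), e; split=> //; exists d; split=> //.
by rewrite restr_algC.
Qed.
HB.instance Definition _ N M :=
  GRing.isLinear.Build k (mor (C := QB) N M) (mor (F N) (F M)) _
    (@qforget N M) (@qforget_linear N M).

Lemma qforget_comp X Y M (g : mor (C := QB) Y M) (f : mor (C := QB) X Y) :
  qforget (g \oc f) = qforget g \oc qforget f.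
Proof.
elim/qclassW: g => g; elim/qclassW: f => f; rewrite (qforgetE f) (qforgetE g).
apply: etrans (congr1 (@qforget _ _) (qcompE _ _ _)) _.
apply: etrans (qforgetE _) _; apply: etrans (esym (qcompE _ _ _)).
by apply/qclassP/frac_eqI => n m fm; exists m.
Qed.

Lemma qforget_qmap N M (f : modhom N M) : qforget (qmap b noeB f) = fmap F f.
Proof.
apply: etrans (qforgetE _) _; apply/qclassP/frac_eqI => n m fm.
by exists m.
Qed.

Definition qaction N M : right_action gT (mor (F N) (F M)) :=
  RightAction (ra_fun := fun g => @qact _ _ _ act noeR N M g : {linear _ -> _})
    (@qact1 _ _ _ act noeR N M) (@qactM _ _ _ act noeR N M).

Lemma qact_qforget_comp X Y E g (h : mor (F Y) (F E)) (m : mor (C := QB) X Y) :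
  qaction X E g (h \oc qforget m) = qaction Y E g h \oc qforget m.
Proof.
elim/qclassW: h => h; elim/qclassW: m => m; rewrite (qforgetE m) /=.
rewrite (qactE _ g h).
apply: etrans (congr1 (qact g) (qcompE _ _ _)) _; rewrite qactE.
apply: etrans (esym (qcompE _ _ _)).
apply/qclassP/frac_eqI => x e he; exists e; split=> //.
case: he => [y [my hy]]; exists (gract (y : Y) g); split.
  by rewrite -[x](gractVK g); apply: forget_gract.
by rewrite /= /frac_act_rel gractK.
Qed.

Lemma qact_qforget N M g (q : mor (C := QB) N M) : qaction N M g (qforget q) = qforget q.
Proof.
elim/qclassW: q => f; rewrite (qforgetE f) /= qactE.
apply/qclassP/frac_eqI => n m fm; exists m; split=> //.
by have := forget_gract g fm; rewrite !gractVK.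
Qed.

(* The intersection of all translates of a fraction f is G-stable, and it is
   equivalent to f when the class of f is G-invariant. *)
Lemma qforget_invariant N M (q : mor (F N) (F M)) :
  (forall g, qaction N M g q = q) -> exists q' : mor (C := QB) N M, qforget q' = q.
Proof.
elim/qclassW: q => f inv.
have eqf g : frac_eq (frac_act g f) f.
  by apply/(qclassP noeR); rewrite -[RHS](inv g) /= qactE.
pose rel n m := forall g, frac_act g f n m.
have rel_gract n m h : rel n m -> rel (gract (n : N) h) (gract (m : M) h).
  move=> fnm g; have := fnm (g * h^-1)%g.
  by rewrite /= /frac_act_rel invMg invgK !gractM.
have relD n m n' m' : rel n m -> rel n' m' -> rel (n + n') (m + m').
  by move=> h h' g; apply: fr_D.
have rel0 : rel 0 0 by move=> g; apply: fr_0.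
have relf n m : rel n m -> f n m.
  by move=> /(_ 1%g); rewrite /= /frac_act_rel invg1 !gract1.
have rel_dom : mod_torsion r (M := restr N) (fun=> True) (fun n => exists m, rel n m).
  have eqf' : mod_torsion r (fun=> True)
      (fun n => forall g, exists m', frac_act g f n m' /\ f n m').
    by apply: mod_torsion_forall => g; exact: eqf.
  apply: (mod_torsion_trans noeR _ _ (mod_torsionI (fr_dom f) eqf')).
  - by exists 0.
  - by move=> x y [m hm] [m' hm']; exists (m + m'); apply: relD.
  move=> n [[m fm] /choice [t ht]].
  (* The value [t g] shared with the translate by [g] differs from [m] by an element of the torsion
     fibre of [f] over 0; a common power of [r] removes the difference for all [g]. *)
  have /choice [l hl] : forall g, exists p, forall a, ideal_pow r p a -> t g *> a = m *> a.
    move=> g; have /fr_fib [p hp] : f 0 (t g - m).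
      by rewrite -(subrr n); apply: fr_B => //; case: (ht g).
    by exists p => a /hp; rewrite ractBl => /eqP; rewrite subr_eq0 => /eqP.
  exists (\max_g l g)%N => a ra; exists (m *> a) => g.
  rewrite -(hl g); last by apply: ideal_pow_leq ra; apply: leq_bigmax.
  by apply: fr_Z; case: (ht g).
have @f' : frac b N M.
  apply: (@Frac k B b N M rel) => //.
  - move=> n m a nm; rewrite !ract_decomp; elim/big_ind2: _ => // [*|g _]; first exact: relD.
    by apply: rel_gract => h; exact: (@fr_Z _ _ _ _ _ (frac_act h f) n m _ (nm h)).
  - apply: mod_torsion_skew rel_dom; first by exists 0.
      by move=> x y [m hm] [m' hm']; exists (m + m'); apply: relD.
    by move=> x g [m hm]; exists (gract m g); apply: rel_gract.
  - apply: mod_torsion_skew => //.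
    + by move=> x y -> ->; rewrite addr0.
    + by move=> x g ->; rewrite gract0.
    + by move=> m /relf; apply: fr_fib.
exists (qclass noeB f'); rewrite (qforgetE f'); apply/qclassP/frac_eqI => n m nm.
by exists m; split=> //; exact: (relf _ _ nm).
Qed.

Hypothesis arR : right_artin_rees r.
Hypothesis char_G : (#|gT|%:R : k) != 0.

Lemma injective_res_quotient E : @injective_obj k (Mod B) E -> injective_obj (F E).
Proof. by move=> /baer_restr; apply: qinjective. Qed.

(* Averaging an extension in QR over G makes it a morphism of QB. *)
Lemma injective_quotient E : @injective_obj k (Mod B) E -> injective_obj (E : QB).
Proof.
move=> injE X Y; elim/qclassW=> m mm; elim/qclassW=> f.
have mtors x : forget m x 0 -> Gamma r x.
  move=> /(qmono_torsion mm) [p hp]; exists p => a ra; apply: hp; exact: skew_embed_pow.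
have [h eh] := frac_extend noeR arR (forget f) (baer_restr injE) mtors.
have [h' eh'] := qforget_invariant (ravg_invariant (qaction Y E) (qclass noeR h)).
exists h'; apply: qforget_inj; rewrite qforget_comp eh'.
(* Averaging commutes with composition by the class of [m] and fixes that of [f], both coming from
   [QB]. *)
transitivity (ravg (qaction X E) (qforget (qclass noeB f))); last first.
  by apply: ravg_id => // g; apply: qact_qforget.
rewrite /ravg mcompZl; congr (_ *: _).
rewrite (big_morph (fun u => u \oc qforget (qclass noeB m : mor (C := QB) X Y))
  (fun u v => mcompDl u v _) (mcomp0l _ _)).
apply: eq_bigr => g _; rewrite -qact_qforget_comp; congr (_ _).
by rewrite (qforgetE m) (qforgetE f).
Qed.

End SkewModules.

(** * Cohomology of the subcomplex of invariants *)

Section InvariantCohomology.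
Variables (k : fieldType) (gT : finGroupType) (V W : kcomplex k) (U : kc_map V W).
Variables (rho : forall n, right_action gT (W n)) (a : gT -> kc_map W W).
Hypothesis char_G : (#|gT|%:R : k) != 0.
Hypothesis aE : forall g n x, a g n x = rho n g x.
Hypothesis U_inj : forall n, injective (U n).
Hypothesis U_inv : forall n x g, rho n g (U n x) = U n x.
Hypothesis U_surj : forall n y, (forall g, rho n g y = y) -> exists x, U n x = y.

Lemma ravg_d n y : ravg (rho n.+1) (kd W n y) = kd W n (ravg (rho n) y).
Proof.
rewrite /ravg [RHS]linearZ /=; congr (_ *: _); rewrite linear_sum; apply: eq_bigr => g _.
by rewrite -!aE km_comm.
Qed.

(** If [U z] is the coboundary of [y], it is also that of the average of [y], which comes from
    [V]. *)
Lemma coho_invariant_inj n : injective (@coho_map _ _ _ U n).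
Proof.
elim/quo_piW=> x; elim/quo_piW=> y; rewrite -!/(coho_class _) !coho_mapE.
move=> /coho_class_eq /=; rewrite -linearB => cob; apply/coho_class_eq.
move: (val x - val y) cob; case: n {x y} => [|n] z /=.
  by rewrite -[in RHS](linear0 (U 0%N)) => /U_inj.
move=> [y yz]; have [x xy] := U_surj (ravg_invariant (rho n) y).
exists x; apply: U_inj; rewrite km_comm xy -ravg_d -yz.
by rewrite ravg_id.
Qed.

(** An invariant class is the average of its translates, hence is represented by the average of a
    cocycle, which comes from [V]. *)
Lemma coho_invariantP n (y : cohomology W n) :
  (forall g, coho_map (a g) y = y) <-> exists x, coho_map U x = y.
Proof.
split=> [|[x <-] g]; last first.
  elim/quo_piW: x => x; rewrite -/(coho_class x) !coho_mapE; congr coho_class.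
  by apply: val_inj; rewrite /= aE U_inv.
elim/quo_piW: y => y; rewrite -/(coho_class y) => inv.
have [x xy] := U_surj (ravg_invariant (rho n) (val y)).
have dx : cocycles V n x.
  apply: U_inj; rewrite km_comm xy -ravg_d (asboolW (sub_in y) : kd W n (val y) = 0).
  by rewrite linear0 /ravg big1 ?scaler0 // => g _; rewrite linear0.
exists (coho_class (SubMod (asboolT dx))); rewrite coho_mapE.
transitivity ((#|gT|%:R)^-1 *: \sum_(g : gT) coho_map (a g) (coho_class y)).
  rewrite /coho_class; under eq_bigr => g _ do rewrite -/(coho_class y) coho_mapE /coho_class.
  rewrite -linear_sum -linearZ; congr (quo_pi _ _); apply: val_inj.
  rewrite linearZ linear_sum /= xy; congr (_ *: _).
  by apply: eq_bigr => g _; rewrite aE.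
under eq_bigr do rewrite inv.
by rewrite sumr_const cardT -cardE -scaler_nat scalerA mulVf // scale1r.
Qed.

Fact coho_action_1 n (x : cohomology W n) : coho_map (a 1%g) x = x.
Proof.
elim/quo_piW: x => x; rewrite -/(coho_class x) coho_mapE; congr coho_class.
by apply: val_inj; rewrite /= aE ra_1.
Qed.

Fact coho_action_M n g h (x : cohomology W n) :
  coho_map (a (g * h)%g) x = coho_map (a h) (coho_map (a g) x).
Proof.
elim/quo_piW: x => x; rewrite -/(coho_class x) !coho_mapE; congr coho_class.
by apply: val_inj; rewrite /= !aE ra_M.
Qed.

Definition coho_action n : right_action gT (cohomology W n) :=
  @RightAction k gT _ (fun g => coho_map (a g) (n := n)) (@coho_action_1 n) (@coho_action_M n).

End InvariantCohomology.

(** * Transport along linear bijections *)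

(** The isomorphism is [al] after the inverse of [be] on its image [P]. *)
Lemma linear_sub_bij (k : fieldType) (A V W : lmodType k) (P : submod V)
    (al : {linear A -> W}) (be : {linear A -> V}) :
  bijective al -> injective be -> (forall v, P v <-> exists x, be x = v) ->
  exists f : {linear sub_mod P -> W}, bijective f.
Proof.
move=> al_bij be_inj Pim.
have /choice [g hg] : forall v : sub_mod P, exists x, be x = val v.
  by move=> v; apply/Pim; exact: (asboolW (sub_in v)).
have fP : linear (al \o g).
  move=> c v w; rewrite /= -linearP; congr (al _); apply: be_inj.
  by rewrite linearP !hg linearP.
pose fL := GRing.isLinear.Build _ _ _ _ (al \o g) fP.
pose f : {linear sub_mod P -> W} := HB.pack (al \o g) fL.
exists f; apply: (bij_comp al_bij).
have Pbe x : sm_pred P (be x) by apply/asboolP/Pim; exists x.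
exists (fun x => SubMod (Pbe x)) => [v|x].
  by apply: val_inj; rewrite /= hg.
by apply: be_inj; rewrite hg.
Qed.

Lemma transport_action (k : fieldType) (gT : finGroupType) (V W : lmodType k)
    (h : {linear V -> W}) (rho : right_action gT V) : bijective h ->
  exists rho' : right_action gT W, forall g x, h (rho g x) = rho' g (h x).
Proof.
move=> [h' hK h'K]; pose act g w := h (rho g (h' w)).
have act_linear g : linear (act g).
  move=> c v w; rewrite /act -!linearP; congr (h (rho g _)); apply: (can_inj hK).
  by rewrite h'K linearP !h'K.
pose actL g : {linear W -> W} :=
  HB.pack (act g) (GRing.isLinear.Build _ _ _ _ (act g) (act_linear g)).
have act1 w : actL 1%g w = w by rewrite /= /act ra_1 h'K.
have actM g g' w : actL (g * g')%g w = actL g' (actL g w).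
  by rewrite /= /act hK ra_M.
by exists (RightAction act1 actM) => g x; rewrite /= /act hK.
Qed.

(** * The resolution over [B] and its comparison with those in the quotients *)

Section ModInjres.
Variables (k : fieldType) (S : algType k) (M : Mod S) (I : injres M).

Lemma injres_aug_inj x : (ir_aug I : modhom _ _) x = 0 -> x = 0.
Proof. exact: (mod_mono_inj (ir_mono (i := I))). Qed.

Lemma injres_exact0 y : (cx_d I 0 : modhom _ _) y = 0 ->
  exists x, y = (ir_aug I : modhom _ _) x.
Proof. exact: (mod_exactP (ir_exact0 I)). Qed.

Lemma injres_exact n y : (cx_d I n.+1 : modhom _ _) y = 0 ->
  exists x, y = (cx_d I n : modhom _ _) x.
Proof. exact: (mod_exactP (ir_exact I n)). Qed.

End ModInjres.

Theorem proposition8p3 (k : fieldType) (gT : finGroupType) (R : algType k)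
    (act : modalg_action gT R)
    (nontrivial_G : (1 < #|gT|)%N)
    (char_G : forall p, p \in [pchar k] -> ~~ (p %| #|gT|)%N)
    (noeR : noetherian R)
    (arR : right_artin_rees (Gradical act))
    (N M : lmodType (skewalg act)^c)
    (fgN : fin_gen N)
    (I : @injres k (Mod (skewalg act)) M)
    (J : injres (to_QModR act noeR M))
    (K : injres (to_QModB act noeR M)) :
  exists rho : forall i : nat, right_action gT (Ext (to_QModR act noeR N) J i),
    [/\ inhabited (res_comparison I J),
        forall (phi : res_comparison I J) (i : nat),
          let H := @coho_map _ _ _ (hom_complex_map (to_QModR act noeR N) phi) i in
          bijective H /\
          forall (g : gT) x,
            H (coho_map (hom_action (proj2 noeR) N I g) x) = rho i g (H x)
      & forall i : nat,
          exists f : {linear sub_mod (invariants (rho i)) ->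
                             Ext (to_QModB act noeR N) K i},
            bijective f].
Proof.
have char0 : (#|gT|%:R : k) != 0.
  apply/negP => /eqP e; have [p pk] := natf0_pchar (ltnW nontrivial_G) (introT eqP e).
  by move: (char_G p pk); rewrite (dvdn_pcharf pk) e eqxx.
pose QF := to_QModR act noeR; pose QG := to_QModB act noeR.
pose FI := fmap_cx QF I; pose GI := fmap_cx QG I.
have injFI n : injective_obj (FI n).
  exact: (injective_res_quotient (noeR := proj2 noeR) arR (@ir_inj _ _ _ I n)).
have injGI n : injective_obj (GI n).
  exact: (injective_quotient (noeR := proj2 noeR) arR char0 (@ir_inj _ _ _ I n)).
(* Exactness of [I] is a statement on elements, so the restriction to [R] inherits it, and
   [lifts_to_qmap] carries it to the quotient. *)
have liftF E : injective_obj E -> lifts_to (D := FI) (fmap QF (ir_aug I)) E.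
  apply: (lifts_to_qmap (D := fmap_cx (restriction act) I) (aug := restr_hom (ir_aug I))).
  - exact: (@injres_aug_inj _ _ _ I).
  - exact: (@injres_exact0 _ _ _ I).
  - exact: (@injres_exact _ _ _ I).
have liftG E : injective_obj E -> lifts_to (D := GI) (fmap QG (ir_aug I)) E.
  apply: lifts_to_qmap.
  - exact: (@injres_aug_inj _ _ _ I).
  - exact: (@injres_exact0 _ _ _ I).
  - exact: (@injres_exact _ _ _ I).
have daugF : cx_d FI 0 \oc fmap QF (ir_aug I) = 0.
  by rewrite -fmapM (exact_comp (ir_exact0 I)) fmap0.
have daugG : cx_d GI 0 \oc fmap QG (ir_aug I) = 0.
  by rewrite -fmapM (exact_comp (ir_exact0 I)) fmap0.
have liftJ E : injective_obj E -> lifts_to (ir_aug J) E by apply: lifts_to_injres.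
have liftK E : injective_obj E -> lifts_to (ir_aug K) E by apply: lifts_to_injres.
have [phi0 ephi0] := cx_map_exists (fun n => liftF _ (@ir_inj _ _ _ J n))
  (exact_comp (ir_exact0 J)).
have [psi epsi] := cx_map_exists (fun n => liftG _ (@ir_inj _ _ _ K n))
  (exact_comp (ir_exact0 K)).
have bijF (phi : res_comparison I J) i :
    bijective (@coho_map _ _ _ (hom_complex_map (QF N) phi) i).
  apply: (@coho_map_bij _ _ _ FI J (fmap QF (ir_aug I)) (ir_aug J)) => // [n|n|n|].
  - exact: (liftF _ (injFI n)).
  - exact: (liftJ _ (@ir_inj _ _ _ J n)).
  - exact: (liftJ _ (injFI n)).
  - exact: cmp_aug.
have bijG i : bijective (@coho_map _ _ _ (hom_complex_map (QG N) psi) i).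
  apply: (@coho_map_bij _ _ _ GI K (fmap QG (ir_aug I)) (ir_aug K)) => // n.
  - exact: (liftG _ (injGI n)).
  - exact: (liftK _ (@ir_inj _ _ _ K n)).
  - exact: (liftK _ (injGI n)).
pose Phi0 : res_comparison I J := Comparison ephi0.
have U_comm n (q : mor (QG N) (GI n)) : qforget (cx_d GI n \oc q) = cx_d FI n \oc qforget q.
  by rewrite qforget_comp qforget_qmap.
pose U : kc_map (hom_complex (QG N) GI) (hom_complex (QF N) FI) :=
  @KcMap k (hom_complex (QG N) GI) (hom_complex (QF N) FI)
    (fun n => @qforget _ _ _ act (proj2 noeR) N (I n) : {linear _ -> _}) U_comm.
pose rhoF n := qaction (proj2 noeR) N (I n).
pose a g := hom_action (proj2 noeR) N I g.
have aE g n x : a g n x = rhoF n g x by [].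
have U_inj n : injective (U n) by apply: qforget_inj.
have U_inv n x g : rhoF n g (U n x) = U n x by apply: qact_qforget.
have U_surj n y : (forall g, rhoF n g y = y) -> exists x, U n x = y.
  exact: qforget_invariant.
pose H0 i := @coho_map _ _ _ (hom_complex_map (QF N) Phi0) i.
(* The action on the cohomology of Hom([N], [FI]) is carried to Ext computed with [J] by way of
   [Phi0]. *)
have rhoP i := transport_action (coho_action aE i) (bijF Phi0 i).
exists (fun i => projT1 (cid (rhoP i))); split.
- exact: (inhabits Phi0).
- move=> phi i H; split; first exact: bijF.
  (* All comparisons induce the same map on cohomology, so the action does not depend on the choice
     of [Phi0]. *)
  have HE : H =1 H0 i.
    apply: (@coho_map_unique _ _ _ FI J (fmap QF (ir_aug I))).
      move=> n; exact: (liftF _ (@ir_inj _ _ _ J n)).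
    exact: etrans (cmp_aug phi) (esym (cmp_aug Phi0)).
  by move=> g x; rewrite !HE; case: (cid (rhoP i)) => rho /= <-.
move=> i; case: (cid (rhoP i)) => rho /= hrho.
have H0_inj : injective (H0 i) by apply: bij_inj (bijF Phi0 i).
(* The cohomology of Hom([N], [GI]) mediates: it maps bijectively to Ext computed with [K], and
   injectively to Ext computed with [J], with the invariants as image. *)
apply: (@linear_sub_bij _ _ _ _ (invariants rho)
  (coho_map (hom_complex_map (QG N) psi) (n := i))
  (coho_map (hom_complex_map (QF N) Phi0) (n := i) \o coho_map U (n := i))).
- exact: bijG.
- by apply: inj_comp; [exact: H0_inj|exact: (coho_invariant_inj char0 aE U_inj U_inv U_surj)].
move=> v; have [H0' _ H0'K] := bijF Phi0 i.
rewrite -[v]H0'K; move: (H0' v) => x.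
transitivity (forall g, coho_map (a g) x = x).
  split=> h g; last by rewrite -hrho /= h.
  by apply: H0_inj; exact: (etrans (hrho g x) (h g)).
apply: (iff_trans (coho_invariantP char0 aE U_inj U_inv U_surj x)).
split=> [[y <-]|[y /H0_inj <-]]; by exists y.
Qed.
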